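(* Let $\mathcal{A}$ be a unital $C^*$-algebra. The sets ${\mathcal{M}\Phi_-^+}'(H_{\mathcal{A}})$ and ${\mathcal{M}\Phi_+^-}'(H_{\mathcal{A}})$ are open in $B^a(H_{\mathcal{A}})$ (in the norm topology). Moreover, if $F \in {\mathcal{M}\Phi_+^-}'(H_{\mathcal{A}})$ and $K \in K(H_{\mathcal{A}})$, then $F + K \in {\mathcal{M}\Phi_+^-}'(H_{\mathcal{A}})$; and if $F \in {\mathcal{M}\Phi_-^+}'(H_{\mathcal{A}})$ and $K \in K(H_{\mathcal{A}})$, then $F + K \in {\mathcal{M}\Phi_-^+}'(H_{\mathcal{A}})$.
   Context: $\mathcal{A}$ is a unital $C^*$-algebra; $H_{\mathcal{A}} = \ell^2(\mathcal{A})$ is the standard Hilbert $\mathcal{A}$-module, $B^a(H_{\mathcal{A}})$ is the $C^*$-algebra of bounded adjointable $\mathcal{A}$-linear operators on it, and $K(H_{\mathcal{A}})$ is its closed two-sided ideal of compact operators (the norm closure of the linear span of the operators $z \mapsto x\langle y, z\rangle$). $M \tilde\oplus N$ denotes a direct sum of closed submodules that is not necessarily orthogonal. A Hilbert module is finitely generated if it is the (algebraic) $\mathcal{A}$-linear span of a finite set. An isomorphism of Hilbert modules is a bounded $\mathcal{A}$-linear bijection (with bounded inverse). $N \preceq N'$ means that $N$ is isomorphic to a closed submodule of $N'$. For $F \in B^a(H_{\mathcal{A}})$ consider closed submodules with $H_{\mathcal{A}} = M_1 \tilde\oplus N_1 = M_2 \tilde\oplus N_2$, $F(M_1) \subseteq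 M_2$, $F(N_1) \subseteq N_2$ and $F|_{M_1}: M_1 \to M_2$ an isomorphism. $F \in {\mathcal{M}\Phi_+^-}'(H_{\mathcal{A}})$ if there is such a decomposition with $N_1$ finitely generated and $N_1 \preceq N_2$; $F \in {\mathcal{M}\Phi_-^+}'(H_{\mathcal{A}})$ if there is such a decomposition with $N_2$ finitely generated and $N_2 \preceq N_1$. *)

(* Defs.v *)
From HB Require Import structures.
From mathcomp Require Import all_boot all_order all_algebra.
From mathcomp Require Import all_classical all_reals all_analysis.
From mathcomp.real_closed Require Import complex.

Set Implicit Arguments.
Unset Strict Implicit.
Unset Printing Implicit Defensive.

Import Order.TTheory GRing.Theory Num.Theory.
Import numFieldNormedType.Exports.

Local Open Scope classical_set_scope.
Local Open Scope ring_scope.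

(* The multiplication and its unit belong to the mixin because no structure of
   the library joins a ring with a normed module over another ring (and a join
   with [pzRingType] is rejected for the lack of one below [numDomainType]);
   the ring structure is declared right after.  The zero algebra is allowed. *)
HB.mixin Record isCStarAlgebra (R : realType) (A : Type)
    & CompleteNormedModule (R[i]) A := {
  cstar_one : A;
  cstar_mul : A -> A -> A;
  star : A -> A;
  cstar_mulA : associative cstar_mul;
  cstar_mul1 : left_id cstar_one cstar_mul;
  cstar_mulr1 : right_id cstar_one cstar_mul;
  cstar_mulDl : left_distributive cstar_mul +%R;
  cstar_mulDr : right_distributive cstar_mul +%R;
  cstar_scalerAl : forall (c : R[i]) (a b : A),
    c *: cstar_mul a b = cstar_mul (c *: a) b;
  cstar_scalerAr : forall (c : R[i]) (a b : A),
    c *: cstar_mul a b = cstar_mul a (c *: b);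
  cstar_normM : forall a b : A, `|cstar_mul a b| <= `|a| * `|b|;
  starK : involutive star;
  starD : forall a b : A, star (a + b) = star a + star b;
  starZ : forall (c : R[i]) (a : A), star (c *: a) = conjc c *: star a;
  starM : forall a b : A, star (cstar_mul a b) = cstar_mul (star b) (star a);
  cstar_identity : forall a : A, `|cstar_mul (star a) a| = `|a| ^+ 2
}.

#[short(type="cstarAlgType")]
HB.structure Definition CStarAlgebra (R : realType) :=
  {A of isCStarAlgebra R A & CompleteNormedModule (R[i]) A}.

#[non_forgetful_inheritance]
HB.instance Definition _ (R : realType) (A : cstarAlgType R) :=
  GRing.Zmodule_isPzRing.Build (CStarAlgebra.sort A)
    (@cstar_mulA R A) (@cstar_mul1 R A) (@cstar_mulr1 R A)
    (@cstar_mulDl R A) (@cstar_mulDr R A).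

Section StandardModule.
Context {R : realType} {A : cstarAlgType R}.

(* The norm of a normed module over [R[i]] is an element of [R[i]]; it is a
   nonnegative real, of which this takes the real part. *)
Definition rnorm (a : A) : R := complex.Re `|a|.

(* H_A is carried by a set of sequences, as a right A-module, with the inner
   product linear in its second argument. *)
Definition ell2 : set (A ^nat) :=
  [set x | cvgn (series (fun k => star (x k) * x k))].

Definition inner (x y : A ^nat) : A :=
  limn (series (fun k => star (x k) * y k)).

Definition hnorm (x : A ^nat) : R := Num.sqrt (rnorm (inner x x)).

Definition rmul (x : A ^nat) (a : A) : A ^nat := fun k => x k * a.

(* An operator on H_A is represented by a total function on sequences, of which
   only the values on [ell2] are ever used; likewise for a map between two
   submodules M and N, of which only the values on M are used. *)
Definition additive_on (M : set (A ^nat)) (f : A ^nat -> A ^nat) : Prop :=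
  forall x y, M x -> M y -> f (x + y) = f x + f y.

(* Since A is unital and c *: x = rmul x (c *: 1), A-linear maps are
   complex-linear. *)
Definition Alinear_on (M : set (A ^nat)) (f : A ^nat -> A ^nat) : Prop :=
  additive_on M f /\ forall x a, M x -> f (rmul x a) = rmul (f x) a.

Definition bounded_map_on (M : set (A ^nat)) (f : A ^nat -> A ^nat) : Prop :=
  exists c : R, forall x, M x -> hnorm (f x) <= c * hnorm x.

Definition Ba : set (A ^nat -> A ^nat) := [set F |
  [/\ set_fun ell2 ell2 F, Alinear_on ell2 F, bounded_map_on ell2 F &
      exists2 G, set_fun ell2 ell2 G &
        forall x y, ell2 x -> ell2 y -> inner (F x) y = inner x (G y)]].

Definition opnorm (F : A ^nat -> A ^nat) : R :=
  sup [set hnorm (F x) | x in [set x | ell2 x /\ hnorm x <= 1]].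

Definition open_in_Ba (U : set (A ^nat -> A ^nat)) : Prop :=
  U `<=` Ba /\
  forall F, U F -> exists2 e : R, 0 < e &
    forall D, Ba D -> opnorm (D \- F) < e -> U D.

Definition rank_one (x y : A ^nat) : A ^nat -> A ^nat :=
  fun z => rmul x (inner y z).

Definition rank_one_span : set (A ^nat -> A ^nat) := [set T |
  exists n (c : 'I_n -> R[i]) (x y : 'I_n -> A ^nat),
    (forall i, ell2 (x i) /\ ell2 (y i)) /\
    T = fun z => \sum_(i < n) c i *: rank_one (x i) (y i) z].

Definition compact_op : set (A ^nat -> A ^nat) := [set K |
  Ba K /\ forall e : R, 0 < e ->
    exists2 T, rank_one_span T & opnorm (K \- T) < e].

Definition closed_submodule (M : set (A ^nat)) : Prop :=
  [/\ M `<=` ell2, M 0,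
      forall x y, M x -> M y -> M (x + y),
      forall x a, M x -> M (rmul x a) &
      forall x, ell2 x ->
        (forall e : R, 0 < e -> exists2 y, M y & hnorm (x - y) < e) -> M x].

Definition direct_sum (M N : set (A ^nat)) : Prop :=
  [/\ closed_submodule M, closed_submodule N,
      M `&` N = [set 0] & [set x + y | x in M & y in N] = ell2].

Definition fin_gen (N : set (A ^nat)) : Prop :=
  exists n (g : 'I_n -> A ^nat),
    N = [set \sum_(i < n) rmul (g i) (a i) | a in [set: 'I_n -> A]].

Definition module_iso (M N : set (A ^nat)) (f : A ^nat -> A ^nat) : Prop :=
  [/\ Alinear_on M f, bounded_map_on M f, set_bij M N f &
      exists2 g, (forall x, M x -> g (f x) = x) & bounded_map_on N g].

Definition module_le (N N' : set (A ^nat)) : Prop :=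
  exists L f, [/\ closed_submodule L, L `<=` N' & module_iso N L f].

Definition MPhi_decomposition (F : A ^nat -> A ^nat)
    (M1 N1 M2 N2 : set (A ^nat)) : Prop :=
  [/\ direct_sum M1 N1, direct_sum M2 N2,
      F @` M1 `<=` M2, F @` N1 `<=` N2 & module_iso M1 M2 F].

Definition MPhi_plus_minus' : set (A ^nat -> A ^nat) := [set F |
  Ba F /\ exists M1 N1 M2 N2,
    [/\ MPhi_decomposition F M1 N1 M2 N2, fin_gen N1 & module_le N1 N2]].

Definition MPhi_minus_plus' : set (A ^nat -> A ^nat) := [set F |
  Ba F /\ exists M1 N1 M2 N2,
    [/\ MPhi_decomposition F M1 N1 M2 N2, fin_gen N2 & module_le N2 N1]].

End StandardModule.

Arguments MPhi_plus_minus' {R} A.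
Arguments MPhi_minus_plus' {R} A.
Arguments compact_op {R} A.

(* Main.v *)
Require Import Defs.
From HB Require Import structures.
From mathcomp Require Import all_boot all_order all_algebra.
From mathcomp Require Import all_classical all_reals all_analysis.
From mathcomp.real_closed Require Import complex.
From mathcomp Require Import ring lra.

Set Implicit Arguments.
Unset Strict Implicit.
Unset Printing Implicit Defensive.

Import Order.TTheory GRing.Theory Num.Theory.
Import numFieldNormedType.Exports.

Local Open Scope classical_set_scope.
Local Open Scope complex_scope.
Local Open Scope ring_scope.

(** A decomposition of F in which F restricts to an isomorphism from M1 onto M2
amounts to a bounded A-linear S with S F S = S: S is the projection onto M2
along N2 followed by the inverse of the restriction, and conversely M1 and M2
are the ranges of S F and F S.  In these terms N1 = ker (S F) and N2 = ker S, so
both classes are conditions on two kernels ([decomposition_outer],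
[outer_decomposition]).  The summands need not be orthogonally complemented, so
S is bounded and A-linear but has no adjoint in general.

If 1 + S D has a bounded inverse V, then V S is an outer inverse of F + D, with
ker (V S) = ker S and ker (V S (F + D)) = V (ker (S F)), and the conditions on
the kernels carry over ([perturb_outer], [perturb_ker], [perturb_ker_domain]).
When D is small V is given by a Neumann series, whence openness.

A compact K is not small, but K Q and Q K are, where Q = [tail m] erases the
first m coordinates and m is large ([tail_small_compact]).  So S is changed
first.  Let N be the finitely generated one of the two kernels and P = 1 - S F
or P = 1 - F S the projection onto it.  As N is finitely generated and closed,
Q P is small too ([fin_gen_tail]), so W = 1 - Q P is invertible; the idempotent
E = W^-1 Q W kills N, and its kernel W^-1 (A^m) is again finitely generated
([cofinite_projection]).  If N = ker (S F), then E S is an outer inverse of F,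
with ker (E S F) = ker E; an element x of ker E splits as P x + (x - P x), the
embedding of N in ker S applies to the first part and F to the second, which
embeds ker E in ker (E S) ([plus_compact]).  If N = ker S, then S E plays the
same role, with S in place of F ([minus_compact]).  Now K E S, or S E K, is
small, and the previous paragraph applies to F + K.

Two bodies of theory come before that.  The norm of H_A rests on the order of
A: every star a * a is positive, and the norm is monotone on positive elements.
Both are derived from the C*-identity without spectra, from the square root of
1 - x given by an iteration ([sqrt_1B]).  They yield the Cauchy-Schwarz
inequality and the completeness of H_A.  Then a Baire category argument
([almost_open]) gives the boundedness of the projections of a direct sum
([direct_sum_projection]) and the uniform smallness of tails on finitely
generated closed submodules ([fin_gen_tail]). *)

(** * The algebra with its real-valued norm *)

Section CStar.
Context {R : realType} {A : cstarAlgType R}.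
Implicit Types (a b c h k x y z : A) (s t e : R).

Lemma rnormE a : `|a| = (rnorm a)%:C.
Proof. by rewrite /rnorm RRe_real ?normr_real. Qed.

Lemma rnorm_ge0 a : 0 <= rnorm a.
Proof. by rewrite -ler0c -rnormE normr_ge0. Qed.

Lemma rnorm0 : rnorm (0 : A) = 0.
Proof. by rewrite /rnorm normr0. Qed.

Lemma rnorm_eq0 a : rnorm a = 0 -> a = 0.
Proof. by move=> a0; apply/normr0_eq0; rewrite rnormE a0. Qed.

Lemma rnormD a b : rnorm (a + b) <= rnorm a + rnorm b.
Proof. by rewrite -lecR rmorphD /= -!rnormE ler_normD. Qed.

Lemma rnormM a b : rnorm (a * b) <= rnorm a * rnorm b.
Proof. by rewrite -lecR rmorphM /= -!rnormE cstar_normM. Qed.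

Lemma rnormN a : rnorm (- a) = rnorm a.
Proof. by rewrite /rnorm normrN. Qed.

Lemma rnormB a b : rnorm (a - b) = rnorm (b - a).
Proof. by rewrite -opprB rnormN. Qed.

Lemma rnorm_sub a b : rnorm (a - b) <= rnorm a + rnorm b.
Proof. by rewrite -(rnormN b) rnormD. Qed.

Lemma rnormZ t a : rnorm (t%:C *: a) = `|t| * rnorm a.
Proof.
apply: (@complexI R); rewrite -rnormE normrZ rmorphM /= -rnormE; congr (_ * _).
by rewrite normc_def /= expr0n addr0 sqrtr_sqr.
Qed.

Lemma rnorm_star_mul a : rnorm (star a * a) = rnorm a ^+ 2.
Proof.
apply: (@complexI R); rewrite -rnormE rmorphXn /= -rnormE.
exact: cstar_identity.
Qed.

Lemma rnorm_star a : rnorm (star a) = rnorm a.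
Proof.
have le b : rnorm b <= rnorm (star b).
  have [->|b0] := eqVneq (rnorm b) 0; first exact: rnorm_ge0.
  have bgt0 : 0 < rnorm b by rewrite lt_def b0 rnorm_ge0.
  by rewrite -(ler_pM2r bgt0) -expr2 -rnorm_star_mul rnormM.
by apply/eqP; rewrite eq_le le -{2}(starK a) le.
Qed.

Lemma star0 : star (0 : A) = 0.
Proof. by apply: (@addrI _ (star 0)); rewrite -starD !addr0. Qed.

Lemma starN a : star (- a) = - star a.
Proof. by apply: (@addrI _ (star a)); rewrite -starD !subrr star0. Qed.

Lemma starB a b : star (a - b) = star a - star b.
Proof. by rewrite starD starN. Qed.

Lemma star_mul a b : star (a * b) = star b * star a.
Proof. exact: starM. Qed.

Lemma star1 : star (1 : A) = 1.
Proof. by rewrite -[LHS]mulr1 -{2}[1]starK -star_mul mulr1 starK. Qed.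

Lemma starZr t a : star (t%:C *: a) = t%:C *: star a.
Proof. by rewrite starZ conjc_real. Qed.

Lemma scale_mull (u : R[i]) a b : (u *: a) * b = u *: (a * b).
Proof. by rewrite cstar_scalerAl. Qed.

Lemma scale_mulr (u : R[i]) a b : a * (u *: b) = u *: (a * b).
Proof. by rewrite cstar_scalerAr. Qed.

Lemma real_scaleD s t a : (s + t)%:C *: a = s%:C *: a + t%:C *: a.
Proof. by rewrite rmorphD scalerDl. Qed.

Lemma real_scaleA s t a : s%:C *: (t%:C *: a) = (s * t)%:C *: a.
Proof. by rewrite rmorphM scalerA. Qed.

Lemma real_scale1 a : 1%:C *: a = a.
Proof. by rewrite scale1r. Qed.

Lemma rnorm1 : rnorm (1 : A) <= 1.
Proof.
have := rnorm_star_mul 1; rewrite star1 mulr1 => e1.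
have [->//|n0] := eqVneq (rnorm (1 : A)) 0.
suff -> : rnorm (1 : A) = 1 by [].
by apply: (mulfI n0); rewrite mulr1 -expr2 -e1.
Qed.

Lemma gt0_realC (e : R[i]) : 0 < e -> exists2 r : R, 0 < r & e = r%:C.
Proof.
move=> e0; have eE : e = (complex.Re e)%:C by rewrite RRe_real // gtr0_real.
by exists (complex.Re e) => //; rewrite -ltcR -eE.
Qed.

(** Convergence in A with real tolerances, the form in which all later
limits are taken. *)
Definition tends (u : nat -> A) (l : A) :=
  forall e, 0 < e -> exists N, forall n, (N <= n)%N -> rnorm (u n - l) < e.

Lemma tendsP (u : nat -> A) (l : A) : u @ \oo --> l <-> tends u l.
Proof.
split=> [/cvgrPdist_lt ul e e0|ul].
  have [|N _ uN] := ul e%:C; first by rewrite ltcR.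
  by exists N => n /uN; rewrite rnormE ltcR rnormB.
apply/cvgrPdist_lt => e /gt0_realC [r r0 ->].
have [N uN] := ul _ r0.
by exists N => // n /uN; rewrite /= rnormB rnormE ltcR.
Qed.

Lemma rnorm_complete (u : nat -> A) :
  (forall e, 0 < e -> exists N, forall m n, (N <= m)%N -> (N <= n)%N ->
     rnorm (u m - u n) < e) -> exists l, tends u l.
Proof.
move=> cu; suff /cauchy_cvgP /cvg_ex [l /tendsP] : cauchy (u @ \oo) by exists l.
apply/cauchy_ballP => e /gt0_realC [r r0 ->].
have [N uN] := cu _ r0.
rewrite near_map2; near=> m n; rewrite -ball_normE /= rnormE ltcR.
by apply: uN; [near: m|near: n]; exists N.
Unshelve. all: by end_near.
Qed.

End CStar.

(** * Square roots of 1 - x *)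

Section Positive.
Context {R : realType} {A : cstarAlgType R}.
Implicit Types (a b c h k x y z : A) (s t e : R).

Lemma le_eps_mul s e t : (forall d, 0 < d -> s <= e + d * t) -> s <= e.
Proof.
move=> H; have [t0|t0] := lerP t 0.
  have := H 1 ltr01; rewrite mul1r => /le_trans; apply.
  by rewrite gerDl.
apply/ler_addgt0Pr => d d0.
by have := H (d / t) (divr_gt0 d0 t0); rewrite divfK // gt_eqF.
Qed.

Lemma rnorm_eps0 a t : (forall d, 0 < d -> rnorm a <= d * t) -> a = 0.
Proof.
move=> H; apply/rnorm_eq0/eqP; rewrite eq_le rnorm_ge0 andbT.
by apply: (@le_eps_mul _ _ t) => d /H; rewrite add0r.
Qed.

(** The iteration of [sqrt_1B] at the scalar x = 1: its increments bound those of
the iteration in the algebra. *)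
Definition majorant : nat -> R := fun n => iter n (fun s => (1 + s ^+ 2) / 2) 0.

Lemma majorantS n : majorant n.+1 = (1 + majorant n ^+ 2) / 2.
Proof. by []. Qed.

Lemma majorant_bounds n : 0 <= majorant n <= 1.
Proof.
elim: n => [|n /andP[s0 s1]] /=; first by rewrite lexx ler01.
by rewrite -/(majorant n); apply/andP; split; nra.
Qed.

Lemma majorant_le n m : (n <= m)%N -> majorant n <= majorant m.
Proof.
apply: homo_leq (@le_refl _ R) (@le_trans _ R) _ _ _ => {n m} n.
rewrite /= -/(majorant n); have := majorant_bounds n.
by set s := majorant n => /andP[s0 s1]; nra.
Qed.

Lemma majorant_cauchy e : 0 < e ->
  exists N, forall n m, (N <= n)%N -> (n <= m)%N -> majorant m - majorant n < e.
Proof.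
move=> e0.
have [N _ HN] : \forall n \near \oo, `|sup (range majorant) - majorant n| < e.
  apply: (@cvgr_dist_lt _ R^o); last by [].
  apply: nondecreasing_cvgn; first by move=> n m; exact: majorant_le.
  by exists 1 => _ [n _ <-]; case/andP: (majorant_bounds n).
exists N => n m /HN /=; rewrite ltr_norml => /andP[_ h] _.
apply: le_lt_trans h; rewrite lerD2r; apply: ub_le_sup; last by exists m.
by exists 1 => _ [k _ <-]; case/andP: (majorant_bounds k).
Qed.

Definition commutes a b := a * b = b * a.

(** The iterates of y := (x + y^2) / 2 from 0 are polynomials in x with nonnegative
coefficients, so their increments are dominated by those of [majorant], which
increases and stays below 1.  The limit solves 2 y = x + y^2, that is
(1 - y)^2 = 1 - x, and it inherits from the iterates self-adjointness and
commutation with whatever commutes with x. *)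
Lemma sqrt_1B x : rnorm x <= 1 -> exists y, [/\ rnorm y <= 1,
  (1 - y) * (1 - y) = 1 - x, star x = x -> star y = y &
  forall z, commutes z x -> commutes z y].
Proof.
move=> x1.
pose u : nat -> A := fun n => iter n (fun y => 2^-1%:C *: (x + y * y)) 0.
have uS n : u n.+1 = 2^-1%:C *: (x + u n * u n) by [].
have half : `|2^-1 : R| = 2^-1 by rewrite ger0_norm // invr_ge0.
have un n : rnorm (u n) <= majorant n.
  elim: n => [|n IH]; first by rewrite rnorm0.
  rewrite uS rnormZ half /= -/(majorant n) mulrC ler_pM2r ?invr_gt0 //.
  apply: le_trans (rnormD _ _) _; apply: lerD => //.
  by apply: le_trans (rnormM _ _) _; rewrite expr2 ler_pM ?rnorm_ge0.
have un1 n : rnorm (u n) <= 1.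
  by apply: le_trans (un n) _; case/andP: (majorant_bounds n).
have sqdiff a b s : rnorm a + rnorm b <= s -> rnorm (a * a - b * b) <= s * rnorm (a - b).
  move=> abs; have -> : a * a - b * b = a * (a - b) + (a - b) * b.
    by rewrite mulrBr mulrBl addrA subrK.
  apply: le_trans (rnormD _ _) _.
  apply: (@le_trans _ _ ((rnorm a + rnorm b) * rnorm (a - b))).
    by rewrite [leRHS]mulrDl lerD // ?rnormM // [leRHS]mulrC rnormM.
  by rewrite ler_wpM2r ?rnorm_ge0.
have step n : rnorm (u n.+1 - u n) <= majorant n.+1 - majorant n.
  elim: n => [|n IH].
    rewrite uS /u /= mulr0 addr0 subr0 rnormZ half expr0n /= addr0 subr0 mul1r.
    by rewrite ler_piMr // invr_ge0.
  rewrite (uS n.+1) [X in _ - X](uS n) -scalerBr opprD addrACA subrr add0r.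
  rewrite rnormZ half (majorantS n.+1) [X in _ <= _ - X]majorantS.
  set t := majorant n.+1 in IH *; set s := majorant n in IH *.
  have := sqdiff (u n.+1) (u n) _ (lerD (un n.+1) (un n)).
  rewrite -/t -/s => /le_trans /(_ (ler_wpM2l _ IH)).
  have ts : 0 <= t + s by rewrite addr_ge0 //; apply: le_trans (rnorm_ge0 _) (un _).
  by move=> /(_ ts) ?; lra.
have dist n m : (n <= m)%N -> rnorm (u m - u n) <= majorant m - majorant n.
  move=> /subnK <-; elim: (m - n)%N => [|d IH]; first by rewrite add0n !subrr rnorm0.
  rewrite addSn -(subrK (u (d + n)%N) (u (d + n).+1)) -addrA.
  apply: le_trans (rnormD _ _) _.
  apply: le_trans (lerD (step _) IH) _.
  by rewrite addrA subrK.
have [|y uy] := @rnorm_complete _ _ u.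
  move=> e e0; have [N HN] := majorant_cauchy e0.
  exists N => m n Nm Nn; case/orP: (leq_total m n) => mn.
    by rewrite rnormB; apply: le_lt_trans (dist _ _ mn) (HN _ _ _ _).
  by apply: le_lt_trans (dist _ _ mn) (HN _ _ _ _).
have approx d : 0 < d -> exists n, rnorm (u n - y) <= d /\ rnorm (u n.+1 - y) <= d.
  by move=> /uy [N HN]; exists N; split; apply/ltW/HN.
have y1 : rnorm y <= 1.
  apply: (@le_eps_mul _ _ 1) => d /approx[n [nd _]].
  rewrite -(subKr (u n) y); apply: le_trans (rnorm_sub _ _) _.
  by rewrite mulr1 lerD.
exists y; split => //.
- have fix_y : y = 2^-1%:C *: (x + y * y).
    apply/eqP; rewrite -subr_eq0; apply/eqP/(@rnorm_eps0 _ 2) => d /approx[n [n1 n2]].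
    have -> : y - 2^-1%:C *: (x + y * y) = (y - u n.+1) + (u n.+1 - 2^-1%:C *: (x + y * y)).
      by rewrite addrA subrK.
    apply: le_trans (rnormD _ _) _; rewrite [d * 2]mulr_natr [d *+ 2]mulr2n.
    apply: lerD; first by rewrite rnormB.
    rewrite uS -scalerBr opprD addrACA subrr add0r rnormZ half.
    have := sqdiff (u n) y 2 (lerD (un1 n) y1).
    by move=> ?; lra.
  have yy : x + y * y = y + y.
    by rewrite [in RHS]fix_y -real_scaleD (_ : 2^-1 + 2^-1 = 1 :> R) ?real_scale1 //; lra.
  rewrite mulrBl mul1r mulrBr mulr1.
  have -> : y * y = y + y - x by rewrite -yy addrC addKr.
  by rewrite opprB [y + y - x - y]addrAC addrK addrA subrK.
- move=> xs; have us n : star (u n) = u n.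
    by elim: n => [|n IH]; rewrite ?star0 // uS starZr starD star_mul IH xs.
  apply/eqP; rewrite -subr_eq0; apply/eqP/(@rnorm_eps0 _ 2) => d /approx[n [n1 _]].
  have -> : star y - y = (star y - u n) + (u n - y) by rewrite addrA subrK.
  apply: le_trans (rnormD _ _) _.
  rewrite -{1}us -starB rnorm_star rnormB.
  by rewrite [d * 2]mulr_natr mulr2n lerD.
- move=> z zx; have zu n : commutes z (u n).
    elim: n => [|n IH]; first by rewrite /commutes mulr0 mul0r.
    by rewrite /commutes uS scale_mulr scale_mull mulrDr mulrDl zx mulrA IH -mulrA IH mulrA.
  apply/eqP; rewrite -subr_eq0; apply/eqP/(@rnorm_eps0 _ (2 * rnorm z)) => d /approx[n [n1 _]].
  have -> : z * y - y * z = (u n - y) * z - z * (u n - y).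
    by rewrite mulrBl mulrBr zu opprB [RHS]addrC addrA subrK.
  apply: le_trans (rnorm_sub _ _) _.
  have H1 := rnormM (u n - y) z; have H2 := rnormM z (u n - y).
  have := rnorm_ge0 z; nra.
Qed.

End Positive.

(** * The positive cone *)

Section Cone.
Context {R : realType} {A : cstarAlgType R}.
Implicit Types (a b c h k x y z : A) (s t e : R).

Local Notation "t %:U" := (t%:C *: (1 : A)) (at level 2, format "t %:U").

(** Squares of self-adjoint elements: with this definition the order properties
follow from square roots alone, and that every star a * a belongs to the cone
is the last to be proved, in [pos_star_mul]. *)
Definition pos h := exists2 c : A, star c = c & h = c * c.

Lemma pos_sa h : pos h -> star h = h.
Proof. by case=> c sc ->; rewrite star_mul sc. Qed.

Lemma rnorm_sq c : star c = c -> rnorm (c * c) = rnorm c ^+ 2.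
Proof. by move=> sc; rewrite -{1}sc rnorm_star_mul. Qed.

Lemma rnorm_le_sqr a s : 0 <= s -> rnorm a ^+ 2 <= s ^+ 2 -> rnorm a <= s.
Proof. by move=> s0; rewrite ler_pXn2r // nnegrE rnorm_ge0. Qed.

Lemma star_scale_i a : star ('i%C *: a) = - ('i%C *: star a).
Proof.
rewrite starZ -scaleNr; congr (_ *: _).
by apply/eqP; rewrite eq_complex /= oppr0 !eqxx.
Qed.

Lemma scale_ii a : 'i%C *: ('i%C *: a) = - a.
Proof. by rewrite scalerA -expr2 sqr_i scaleN1r. Qed.

(** The element v = a + i b satisfies star v * v = 1, so its norm is at most 1, and
a is the real part of v.  This replaces the functional calculus as the source of
norm bounds. *)
Lemma pythagoras_le1 a b : star a = a -> star b = b -> commutes a b ->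
  a * a + b * b = 1 -> rnorm a <= 1.
Proof.
move=> sa sb ab1 ab2; pose v := a + 'i%C *: b.
have sv : star v = a - 'i%C *: b by rewrite starD star_scale_i sa sb.
have vv : star v * v = 1.
  rewrite sv /v mulrDr !mulrBl !scale_mull !scale_mulr scale_ii opprK ab1.
  by rewrite addrA subrK.
have v1 : rnorm v <= 1.
  by apply: rnorm_le_sqr => //; rewrite -rnorm_star_mul vv expr1n rnorm1.
have : rnorm (a + a) <= 1 + 1.
  have -> : a + a = v + star v by rewrite sv /v addrACA subrr addr0.
  by apply: le_trans (rnormD _ _) _; rewrite lerD // rnorm_star.
have -> : a + a = 2%:C *: a by rewrite (_ : 2 = 1 + 1 :> R) // real_scaleD real_scale1.
rewrite rnormZ ger0_norm //; lra.
Qed.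

Lemma scale_sqr t a : (t%:C *: a) * (t%:C *: a) = (t ^+ 2)%:C *: (a * a).
Proof. by rewrite scale_mull scale_mulr real_scaleA expr2. Qed.

Lemma commutesZ z t a : commutes z a -> commutes z (t%:C *: a).
Proof. by rewrite /commutes scale_mull scale_mulr => ->. Qed.

Lemma commutes1B z a : commutes z a -> commutes z (1 - a).
Proof. by rewrite /commutes mulrBl mulrBr mul1r mulr1 => ->. Qed.

Lemma commutesM z a b : commutes z a -> commutes z b -> commutes z (a * b).
Proof. by move=> za zb; rewrite /commutes mulrA za -mulrA zb mulrA. Qed.

(** If e is the square root of 1 - c^2 then e^2 + c^2 = 1 and e commutes with c, so
the norm of e is at most 1 by [pythagoras_le1]. *)
Lemma rnorm_1B_sqr c : star c = c -> rnorm c <= 1 -> rnorm (1 - c * c) <= 1.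
Proof.
move=> sc c1.
have cc1 : rnorm (c * c) <= 1 by rewrite rnorm_sq // expr_le1 // rnorm_ge0.
have [y [y1 yy ys yc]] := sqrt_1B cc1.
have sy : star (1 - y) = 1 - y by rewrite starB star1 ys // star_mul sc.
rewrite -yy rnorm_sq // expr_le1 ?rnorm_ge0 //.
apply: (@pythagoras_le1 _ c) => //; last by rewrite yy subrK.
by apply/esym/commutes1B/yc/commutesM.
Qed.

(** With [pos_of_dist] this turns positivity of a self-adjoint h into the metric
condition |t - h| <= t, from which stability under sums is a triangle
inequality. *)
Lemma pos_dist h t : pos h -> rnorm h <= t -> rnorm (t%:U - h) <= t.
Proof.
move=> [c sc ->] ct; have t0 : 0 <= t := le_trans (rnorm_ge0 _) ct.
move: t0; rewrite le_eqVlt => /orP[/eqP t0|t0].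
  move: ct; rewrite -t0 => ct; rewrite scale0r sub0r rnormN //.
pose r := Num.sqrt t; have r0 : 0 < r by rewrite sqrtr_gt0.
have rr : r ^+ 2 = t by rewrite sqr_sqrtr // ltW.
pose d := r^-1%:C *: c.
have sd : star d = d by rewrite starZr sc.
have dd : c * c = t%:C *: (d * d).
  by rewrite scale_sqr real_scaleA -rr -exprMn divff ?gt_eqF // expr1n real_scale1.
have d1 : rnorm d <= 1.
  rewrite rnormZ gtr0_norm ?invr_gt0 // mulrC ler_pdivrMr // mul1r.
  by apply: rnorm_le_sqr; [exact: ltW|rewrite -rnorm_sq // rr].
rewrite dd -scalerBr rnormZ gtr0_norm // -[leRHS]mulr1 ler_pM2l //.
exact: rnorm_1B_sqr.
Qed.

(** The root is sqrt t (1 - y), with y the solution of [sqrt_1B] for 1 - h / t.  The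
bound on its distance to sqrt t makes the root itself positive. *)
Lemma pos_of_dist h t : star h = h -> rnorm (t%:U - h) <= t ->
  exists c, [/\ star c = c, h = c * c, rnorm ((Num.sqrt t)%:U - c) <= Num.sqrt t &
    forall z, commutes z h -> commutes z c].
Proof.
move=> sh ht; have t0 : 0 <= t := le_trans (rnorm_ge0 _) ht.
move: t0; rewrite le_eqVlt => /orP[/eqP t0|t0].
  exists 0; split; rewrite ?star0 ?mulr0 //.
  - apply: rnorm_eq0; apply/eqP; rewrite eq_le rnorm_ge0 andbT.
    by move: ht; rewrite -t0 scale0r sub0r rnormN.
  - by rewrite -t0 sqrtr0 scale0r subr0 rnorm0.
  - by move=> z _; rewrite /commutes mulr0 mul0r.
pose x := 1 - t^-1%:C *: h.
have xE : t%:C *: x = t%:U - h.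
  by rewrite scalerBr real_scaleA divff ?gt_eqF // real_scale1.
have x1 : rnorm x <= 1.
  by rewrite -(ler_pM2l t0) mulr1 -{1}(gtr0_norm t0) -rnormZ xE.
have [y [y1 yy ys yc]] := sqrt_1B x1.
have r0 : 0 < Num.sqrt t by rewrite sqrtr_gt0.
exists ((Num.sqrt t)%:C *: (1 - y)); split.
- by rewrite starZr starB star1 ys // /x starB star1 starZr sh.
- rewrite scale_sqr yy sqr_sqrtr ?ltW // scalerBr xE opprB addrC subrK //.
- rewrite -scalerBr rnormZ gtr0_norm // subKr.
  by rewrite -[leRHS]mulr1 ler_pM2l.
- by move=> z zh; apply/commutesZ/commutes1B/yc/commutes1B/commutesZ.
Qed.

Lemma pos_dist_pos h t : star h = h -> rnorm (t%:U - h) <= t -> pos h.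
Proof. by move=> sh /(pos_of_dist sh)[c [sc hc _ _]]; exists c. Qed.

Lemma pos_root h : pos h -> exists r, [/\ pos r, h = r * r &
  forall z, commutes z h -> commutes z r].
Proof.
move=> ph; have [c [sc hc cd cc]] := pos_of_dist (pos_sa ph) (pos_dist ph (lexx _)).
by exists c; split=> //; exact: pos_dist_pos cd.
Qed.

Lemma posD h k : pos h -> pos k -> pos (h + k).
Proof.
move=> ph pk; apply: (@pos_dist_pos _ (rnorm h + rnorm k)).
  by rewrite starD !pos_sa.
rewrite real_scaleD opprD addrACA; apply: le_trans (rnormD _ _) _.
by rewrite lerD // pos_dist.
Qed.

Lemma pos0 : pos 0.
Proof. by exists 0; rewrite ?star0 ?mulr0. Qed.

Lemma pos_sum (I : Type) (r : seq I) (P : pred I) (F : I -> A) :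
  (forall i, P i -> pos (F i)) -> pos (\sum_(i <- r | P i) F i).
Proof. by move=> F0; elim/big_ind: _ => //; [exact: pos0|exact: posD]. Qed.

Lemma posZ t h : 0 <= t -> pos h -> pos (t%:C *: h).
Proof.
move=> t0 [c sc ->]; exists ((Num.sqrt t)%:C *: c); first by rewrite starZr sc.
by rewrite scale_sqr sqr_sqrtr.
Qed.

Lemma pos_normB h t : star h = h -> rnorm h <= t -> pos (t%:U - h).
Proof.
move=> sh ht; apply: (@pos_dist_pos _ t); first by rewrite starB starZr star1 sh.
by rewrite opprB addrC subrK.
Qed.

(** For t > |h + k| both h and t - h are positive.  The root of t - h commutes with
whatever commutes with h, hence with the root of h, and the two squares add up
to t: [pythagoras_le1] bounds the root of h by sqrt t. *)
Lemma pos_le_norm h k : pos h -> pos k -> rnorm h <= rnorm (h + k).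
Proof.
move=> ph pk; apply/ler_addgt0Pr => e e0.
set t := rnorm (h + k) + e.
have t0 : 0 < t by rewrite ltr_wpDl ?rnorm_ge0.
have [x [px hx xc]] := pos_root ph.
have pq : pos (t%:U - h).
  have -> : t%:U - h = (t%:U - (h + k)) + k.
    by rewrite opprD addrA subrK.
  by apply: posD => //; apply: pos_normB; rewrite ?starD ?pos_sa // lerDl ltW.
have [q [pq' hq qc]] := pos_root pq.
have xq : commutes x q.
  apply: qc; rewrite /commutes mulrBl mulrBr scale_mull scale_mulr mul1r mulr1 hx.
  by rewrite mulrA.
pose r := Num.sqrt t; have r0 : 0 < r by rewrite sqrtr_gt0.
have rr : r ^+ 2 = t by rewrite sqr_sqrtr // ltW.
have ri : (r^-1) ^+ 2 * t = 1 by rewrite -rr -exprMn mulVf ?gt_eqF // expr1n.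
have : rnorm (r^-1%:C *: x) <= 1.
  apply: (@pythagoras_le1 _ (r^-1%:C *: q)).
  - by rewrite starZr pos_sa.
  - by rewrite starZr pos_sa.
  - by rewrite /commutes !scale_mull !scale_mulr xq.
  by rewrite !scale_sqr -scalerDr -hx -hq addrC subrK real_scaleA ri real_scale1.
rewrite rnormZ gtr0_norm ?invr_gt0 // mulrC ler_pdivrMr // mul1r => xr.
rewrite hx rnorm_sq ?pos_sa // -rr ler_pXn2r // nnegrE ?rnorm_ge0 // ltW //.
Qed.

Lemma rnorm_mul_star a : rnorm (a * star a) = rnorm a ^+ 2.
Proof. by rewrite -{1}(starK a) rnorm_star_mul rnorm_star. Qed.

(** Twice this element is the sum of the squares of the self-adjoint elements
b + star b and i (b - star b). *)
Lemma pos_mul_starD b : pos (b * star b + star b * b).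
Proof.
pose p := b + star b; pose q := 'i%C *: (b - star b).
have sp : star p = p by rewrite starD starK addrC.
have sq : star q = q by rewrite star_scale_i starB starK -scalerN opprB.
have : pos (p * p + q * q) by apply: posD; [exists p|exists q].
have -> : p * p + q * q = 2%:C *: (b * star b + star b * b).
  rewrite /p /q scale_mull scale_mulr scale_ii; set u := b + star b; set v := b - star b.
  have -> : u * u - v * v = b * (u - v) + star b * (u + v).
    rewrite {1}/u {2}/v mulrDl mulrBl opprB [star b * v - _]addrC addrACA.
    by rewrite -mulrBr -mulrDr.
  have twice a : 2%:C *: a = a + a by rewrite (_ : 2 = 1 + 1 :> R) // real_scaleD real_scale1.
  have -> : u - v = star b + star b by rewrite /u /v opprB addrC subrKA.
  have -> : u + v = b + b by rewrite /u /v addrACA subrr addr0.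
  by rewrite twice !mulrDr addrACA.
move=> /(@posZ 2^-1); rewrite real_scaleA mulVf ?pnatr_eq0 // real_scale1; apply.
by rewrite invr_ge0.
Qed.

(** The usual proof compares the spectra of star b * b and b * star b; a norm
estimate does as well.  By [pos_mul_starD], z = b * star b is positive; its
norm is s = |k|, so |s - z| <= s.  From b (s + k) = (s - z) b the C*-identity
gives |(s + k) k (s + k)| <= s^3, while the left side is at least
|2 s k^2| = 2 s^3.  So s = 0. *)
Lemma star_mul_opp_pos_eq0 b k : pos k -> star b * b = - k -> b = 0.
Proof.
move=> pk bk; pose z := b * star b; pose s := rnorm k.
have sE : s = rnorm b ^+ 2 by rewrite /s -rnormN -bk rnorm_star_mul.
have s0 : 0 <= s := rnorm_ge0 k.
have pz : pos z.
  by rewrite -[z](addrK (star b * b)) {2}bk opprK; apply: posD => //; exact: pos_mul_starD.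
have zs : rnorm (s%:U - z) <= s.
  by apply: pos_dist => //; rewrite rnorm_mul_star sE.
pose w := s%:U + k.
have sw : star w = w by rewrite starD starZr star1 pos_sa.
have bw : b * w = (s%:U - z) * b.
  by rewrite /w mulrDr mulrBl scale_mulr scale_mull mul1r mulr1 /z -mulrA bk mulrN opprK.
have h1 : rnorm (w * (star b * b) * w) <= s ^+ 2 * s.
  have -> : w * (star b * b) * w = star (b * w) * (b * w).
    by rewrite star_mul sw !mulrA.
  rewrite rnorm_star_mul bw [X in _ <= _ * X]sE -exprMn.
  rewrite ler_pXn2r // ?nnegrE ?mulr_ge0 ?rnorm_ge0 //.
  by apply: le_trans (rnormM _ _) _; rewrite ler_wpM2r ?rnorm_ge0.
have [c sc kc] := pk.
have ck : commutes k c by rewrite /commutes kc mulrA.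
have pkk : pos (k * k) by exists k; rewrite ?pos_sa.
have pkkk : pos (k * k * k).
  exists (k * c); first by rewrite star_mul sc pos_sa // ck.
  by rewrite kc !mulrA.
have e1 : w * k * w =
    (2 * s)%:C *: (k * k) + ((s ^+ 2)%:C *: k + k * k * k).
  rewrite /w mulrDl scale_mull mul1r mulrDr scale_mulr mulr1 scalerDr real_scaleA -expr2.
  rewrite mulrDl scale_mull (_ : 2 * s = s + s) ?real_scaleD; last by rewrite mulr_natl mulr2n.
  by rewrite addrA [in RHS]addrCA addrA [in RHS]addrA.
(* of the three positive terms of (s + k) k (s + k), only 2 s k^2 is kept *)
have h2 : 2 * s * s ^+ 2 <= s ^+ 2 * s.
  apply: le_trans h1.
  rewrite bk mulrN mulNr rnormN e1.
  apply: le_trans (pos_le_norm _ _).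
  - rewrite rnormZ rnorm_sq ?pos_sa // ger0_norm // mulr_ge0 //.
  - by apply: posZ; rewrite ?mulr_ge0.
  - by apply: posD => //; apply: posZ; rewrite ?sqr_ge0.
have b0 : rnorm b ^+ 2 = 0.
  rewrite -sE; apply/eqP; rewrite eq_le s0 andbT leNgt; apply/negP => s1.
  have : 0 < s ^+ 2 * s by rewrite mulr_gt0 // exprn_gt0.
  move: h2; lra.
by apply: rnorm_eq0; apply/eqP; rewrite -sqrf_eq0 b0.
Qed.

(** Let h = star a * a, r the root of h^2, and d = r - h, which is twice the
negative part of h.  Then h d = - r d, so b = a d satisfies star b * b = - r d^2,
and r d^2 is the square of (sqrt r) d, whence b = 0 by [star_mul_opp_pos_eq0].
It follows that r d = 0, then d^2 = 2 r d = 0, and h = r. *)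
Lemma pos_star_mul a : pos (star a * a).
Proof.
set h := star a * a.
have sh : star h = h by rewrite star_mul starK.
have phh : pos (h * h) by exists h.
have [r [pr hr rc]] := pos_root phh.
have hrC : commutes h r by apply: rc; rewrite /commutes mulrA.
have [k [pk rk kc]] := pos_root pr.
have sk := pos_sa pk; have sr := pos_sa pr.
pose d := r - h.
have sd : star d = d by rewrite starB sr sh.
have hk : commutes h k by apply: kc.
have rkC : commutes r k by apply: kc.
have kd : commutes k d by rewrite /commutes mulrBl mulrBr -rkC hk.
have hd : h * d = - (r * d).
  by rewrite mulrBr hr mulrBr hrC opprB.
have dd : d * d = r * d + r * d.
  by rewrite {1}/d mulrBl hd opprK.
have b0 : a * d = 0.
  apply: (@star_mul_opp_pos_eq0 _ ((k * d) * (k * d))).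
    by exists (k * d) => //; rewrite star_mul sd sk kd.
  have dr : d * r = r * d by rewrite /d mulrBl mulrBr hrC.
  rewrite star_mul sd mulrA -(mulrA d) -/h -(mulrA d) hd mulrN; congr (- _).
  by rewrite [LHS]mulrA dr rk -!mulrA; congr (k * _); rewrite mulrA [in LHS]kd -mulrA.
have rd0 : r * d = 0.
  apply: oppr_inj; rewrite -hd oppr0 /h -mulrA b0 mulr0 //.
have d0 : d = 0.
  by apply: rnorm_eq0; apply/eqP; rewrite -sqrf_eq0 -rnorm_sq // dd rd0 addr0 rnorm0.
by have -> : h = r by apply/esym/eqP; rewrite -subr_eq0 -/d d0.
Qed.

Lemma telescope_mid (S P T B : A) : S - P + B + (T - S) = T - P + B.
Proof. by rewrite [LHS]addrC addrA subrKA. Qed.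

(** In the application x = <u, u>, y = <v, v> and z = <u, v>, and the hypothesis is
the positivity of <u a - v, u a - v>.  For t > |x| the element t - x is
positive, and with a = z / t the hypothesis then gives star z * z <= t y. *)
Lemma cauchy_schwarz_pos x y z : star x = x ->
  (forall a, pos (star a * x * a - (star a * z + star z * a) + y)) ->
  rnorm z ^+ 2 <= rnorm x * rnorm y.
Proof.
move=> sx H.
apply: (@le_eps_mul _ _ _ (rnorm y)) => e e0; rewrite -mulrDl.
set t := rnorm x + e; have t0 : 0 < t by rewrite ltr_wpDl ?rnorm_ge0.
have : pos (t%:U - x) by apply: pos_normB; rewrite // lerDl ltW.
case=> c sc hc.
have [a aE] : exists a, a = t^-1%:C *: z by eexists.
have : pos (y - t^-1%:C *: (star z * z)).
  have -> : y - t^-1%:C *: (star z * z) =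
    (star a * x * a - (star a * z + star z * a) + y) + star (c * a) * (c * a).
    have -> : star (c * a) * (c * a) = star a * (t%:C *: a) - star a * x * a.
      rewrite star_mul sc mulrA -(mulrA _ c c) -hc mulrBr mulrBl.
      by rewrite [star a * _%:U]scale_mulr mulr1 scale_mull ?scale_mulr.
    rewrite telescope_mid.
    have -> : t%:C *: a = z by rewrite aE real_scaleA divff ?gt_eqF // real_scale1.
    by rewrite opprD addrA subrr sub0r [RHS]addrC aE scale_mulr.
  by apply: posD => //; exact: pos_star_mul.
move=> p1; have p2 : pos (t^-1%:C *: (star z * z)).
  by apply: posZ; rewrite ?invr_ge0 ?ltW //; exact: pos_star_mul.
have := pos_le_norm p2 p1; rewrite addrC subrK rnormZ rnorm_star_mul.
by rewrite gtr0_norm ?invr_gt0 // mulrC ler_pdivrMr // mulrC.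
Qed.

End Cone.

(** * The standard module *)

Section StandardModule.
Context {R : realType} {A : cstarAlgType R}.
Implicit Types (a b c : A) (s t e : R) (x y z : A ^nat) (m n : nat).

Definition pinner n x y : A := \sum_(0 <= k < n) star (x k) * y k.
Definition pnorm n x : R := Num.sqrt (rnorm (pinner n x x)).

(** The complement of the coordinate projection onto A^m. *)
Definition tail m x : A ^nat := fun k => if (k < m)%N then 0 else x k.

Lemma star_sum (I : Type) (r : seq I) (F : I -> A) :
  star (\sum_(i <- r) F i) = \sum_(i <- r) star (F i).
Proof. by elim/big_rec2: _ => [|i u v _ <-]; rewrite ?star0 ?starD. Qed.

Lemma pinner_star n x y : star (pinner n x y) = pinner n y x.
Proof.
by rewrite /pinner star_sum; apply: eq_bigr => k _; rewrite star_mul starK.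
Qed.

Lemma pinnerDr n x y z : pinner n x (y + z) = pinner n x y + pinner n x z.
Proof. by rewrite -big_split; apply: eq_bigr => k _; rewrite /= mulrDr. Qed.

Lemma pinnerDl n x y z : pinner n (x + y) z = pinner n x z + pinner n y z.
Proof. by rewrite -pinner_star pinnerDr starD !pinner_star. Qed.

Lemma pinnerNr n x y : pinner n x (- y) = - pinner n x y.
Proof. by rewrite /pinner -sumrN; apply: eq_bigr => k _; rewrite mulrN. Qed.

Lemma pinnerNl n x y : pinner n (- x) y = - pinner n x y.
Proof. by rewrite -pinner_star pinnerNr starN pinner_star. Qed.

Lemma pinner_rmulr n x y a : pinner n x (rmul y a) = pinner n x y * a.
Proof. by rewrite /pinner mulr_suml; apply: eq_bigr => k _; rewrite mulrA. Qed.

Lemma pinner_rmull n x y a : pinner n (rmul x a) y = star a * pinner n x y.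
Proof. by rewrite -pinner_star pinner_rmulr star_mul pinner_star. Qed.

Lemma pos_pinner n x : pos (pinner n x x).
Proof. by apply: pos_sum => k _; exact: pos_star_mul. Qed.

Lemma pnorm_ge0 n x : 0 <= pnorm n x. Proof. exact: sqrtr_ge0. Qed.

Lemma pnorm_sqr n x : pnorm n x ^+ 2 = rnorm (pinner n x x).
Proof. by rewrite sqr_sqrtr // rnorm_ge0. Qed.

Lemma le_sqr s t : 0 <= s -> 0 <= t -> (s ^+ 2 <= t ^+ 2) = (s <= t).
Proof. by move=> s0 t0; rewrite ler_pXn2r // nnegrE. Qed.

Lemma pinner_CS n x y : rnorm (pinner n x y) <= pnorm n x * pnorm n y.
Proof.
rewrite -le_sqr ?rnorm_ge0 ?mulr_ge0 ?pnorm_ge0 // exprMn !pnorm_sqr.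
apply: cauchy_schwarz_pos => [|a]; first by rewrite pinner_star.
suff <- : pinner n (rmul x a - y) (rmul x a - y) =
  star a * pinner n x x * a - (star a * pinner n x y + star (pinner n x y) * a)
    + pinner n y y by exact: pos_pinner.
rewrite pinnerDl pinnerNl !pinnerDr !pinnerNr !pinner_rmulr !pinner_rmull pinner_star.
by rewrite opprD opprK addrA opprD addrA.
Qed.

Lemma pnormD n x y : pnorm n (x + y) <= pnorm n x + pnorm n y.
Proof.
rewrite -le_sqr ?addr_ge0 ?pnorm_ge0 // pnorm_sqr pinnerDl !pinnerDr sqrrD !pnorm_sqr.
apply: le_trans (rnormD _ _) _.
apply: (@le_trans _ _ ((rnorm (pinner n x x) + pnorm n x * pnorm n y) +
   (pnorm n x * pnorm n y + rnorm (pinner n y y)))); last by rewrite mulr2n !addrA.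
apply: lerD; apply: le_trans (rnormD _ _) _; rewrite lerD // ?pinner_CS //.
by rewrite mulrC pinner_CS.
Qed.

Lemma pnormN n x : pnorm n (- x) = pnorm n x.
Proof. by rewrite /pnorm pinnerNl pinnerNr opprK. Qed.

Lemma pnorm_rmul n x a : pnorm n (rmul x a) <= pnorm n x * rnorm a.
Proof.
rewrite -le_sqr ?mulr_ge0 ?pnorm_ge0 ?rnorm_ge0 // exprMn !pnorm_sqr.
rewrite pinner_rmulr pinner_rmull; apply: le_trans (rnormM _ _) _.
rewrite expr2 mulrA ler_wpM2r ?rnorm_ge0 // mulrC.
by apply: le_trans (rnormM _ _) _; rewrite rnorm_star.
Qed.

Lemma pnorm_le_pos n m x y (h : A) : pos h -> pinner n y y = pinner m x x + h ->
  pnorm m x <= pnorm n y.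
Proof.
by move=> ph e; rewrite ler_sqrt ?rnorm_ge0 // e pos_le_norm //; exact: pos_pinner.
Qed.

Lemma pnorm_mono n m x : (n <= m)%N -> pnorm n x <= pnorm m x.
Proof.
move=> nm; apply: (@pnorm_le_pos _ _ _ _ (\sum_(n <= k < m) star (x k) * x k)).
  by apply: pos_sum => k _; exact: pos_star_mul.
by rewrite /pinner (big_cat_nat (leq0n n) nm).
Qed.

Lemma pnorm_tail n m x : pnorm n (tail m x) <= pnorm n x.
Proof.
apply: (@pnorm_le_pos _ _ _ _ (\sum_(0 <= k < n) (if (k < m)%N then star (x k) * x k else 0))).
  by apply: pos_sum => k _; case: ifP => _; [exact: pos_star_mul|exact: pos0].
rewrite -big_split; apply: eq_bigr => k _ /=; rewrite /tail.
by case: ifP => _; rewrite ?mulr0 ?add0r ?addr0.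
Qed.

Lemma pnorm_coord n k x : (k < n)%N -> rnorm (x k) <= pnorm n x.
Proof.
move=> kn; apply: le_trans (pnorm_mono x kn).
rewrite -le_sqr ?rnorm_ge0 ?pnorm_ge0 // pnorm_sqr -rnorm_star_mul /pinner big_nat_recr //= addrC.
by apply: pos_le_norm; [exact: pos_star_mul|exact: pos_pinner].
Qed.

Lemma pinner_tail n m x y : (m <= n)%N ->
  pinner n (tail m x) (tail m y) = pinner n x y - pinner m x y.
Proof.
move=> mn; rewrite /pinner ![\sum_(0 <= _ < n) _](big_cat_nat (leq0n m) mn) /=.
rewrite [RHS]addrC addKr big_nat big1 ?add0r => [|k /andP[_ km]]; last first.
  by rewrite /tail km mulr0.
by apply: eq_big_nat => k /andP[mk _]; rewrite /tail ltnNge mk.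
Qed.

Lemma pnorm_tail_small n m x : (n <= m)%N -> pnorm n (tail m x) = 0.
Proof.
move=> nm; rewrite /pnorm /pinner big_nat big1 ?rnorm0 ?sqrtr0 // => k /andP[_ kn].
by rewrite /tail (leq_trans kn nm) mulr0.
Qed.

Lemma pinner_cvg x y l : (series (fun k => star (x k) * y k)) @ \oo --> l <->
  tends (fun n => pinner n x y) l.
Proof. exact: tendsP. Qed.

Definition small_tails x :=
  forall e, 0 < e -> exists m, forall n, pnorm n (tail m x) <= e.

Lemma tail_tail m m' x : (m' <= m)%N -> tail m (tail m' x) = tail m x.
Proof.
move=> mm; apply/funext => k; rewrite /tail; case: ltnP => // mk.
by rewrite ltnNge (leq_trans mm mk).
Qed.

Lemma pnorm_tail_le n m m' x : (m' <= m)%N -> pnorm n (tail m x) <= pnorm n (tail m' x).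
Proof. by move=> mm; rewrite -(tail_tail x mm) pnorm_tail. Qed.

Lemma pinner_cauchy x y : small_tails x -> small_tails y ->
  exists l, tends (fun n => pinner n x y) l.
Proof.
move=> sx sy; apply: rnorm_complete => e e0.
have [m Hm] := sx _ ltr01; have [m' Hm'] := sy (e / 2) (divr_gt0 e0 (ltr0n _ 2)).
have H p q : (maxn m m' <= p)%N -> (p <= q)%N -> rnorm (pinner q x y - pinner p x y) < e.
  rewrite geq_max => /andP[mp m'p] pq; rewrite -pinner_tail //.
  apply: le_lt_trans (pinner_CS _ _ _) _.
  have h1 := le_trans (pnorm_tail_le q x mp) (Hm q).
  have h2 := le_trans (pnorm_tail_le q y m'p) (Hm' q).
  apply: (@le_lt_trans _ _ (1 * (e / 2))); first by rewrite ler_pM ?pnorm_ge0.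
  by rewrite mul1r ltr_pdivrMr // ltr_pMr // ltr1n.
exists (maxn m m') => p q mp mq; case/orP: (leq_total p q) => pq; last exact: H.
by rewrite rnormB; exact: H.
Qed.

(** Membership in H_A as a condition on partial norms only, to which the triangle
inequality of finite sums applies. *)
Lemma ell2P x : ell2 x <-> small_tails x.
Proof.
split=> [|sx]; last first.
  have [l /pinner_cvg xl] := pinner_cauchy sx sx.
  by apply/cvg_ex; exists l.
move=> /cvg_ex [l /pinner_cvg xl] e e0.
have [|N HN] := xl (e ^+ 2 / 2); first by rewrite divr_gt0 ?exprn_gt0.
exists N => n; have [Nn|nN] := leqP N n; last first.
  by rewrite pnorm_tail_small ?ltW // ltnW.
rewrite -le_sqr ?pnorm_ge0 ?(ltW e0) // pnorm_sqr pinner_tail //.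
have -> : pinner n x x - pinner N x x = (pinner n x x - l) - (pinner N x x - l).
  by rewrite opprB addrA subrK.
apply: le_trans (rnorm_sub _ _) _; rewrite [leRHS]splitr.
by rewrite lerD // ltW // HN.
Qed.

Lemma inner_tends x y : ell2 x -> ell2 y -> tends (fun n => pinner n x y) (inner x y).
Proof.
move=> /ell2P sx /ell2P sy; have [l xl] := pinner_cauchy sx sy.
have /pinner_cvg xl' := xl.
rewrite /inner; have -> // : limn (series (fun k => star (x k) * y k)) = l.
exact: cvg_lim xl'.
Qed.

Lemma tends_unique (u : nat -> A) l l' : tends u l -> tends u l' -> l = l'.
Proof.
move=> ul ul'; apply/eqP; rewrite -subr_eq0; apply/eqP/(@rnorm_eps0 _ _ _ 2).
move=> d d0; have [N HN] := ul _ d0; have [N' HN'] := ul' _ d0.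
pose n := maxn N N'.
have -> : l - l' = (u n - l') - (u n - l).
  by rewrite [RHS]addrC opprB subrKA.
apply: le_trans (rnorm_sub _ _) _; rewrite [d * 2]mulr_natr mulr2n.
by rewrite lerD // ltW // ?HN ?HN' // ?leq_maxl ?leq_maxr.
Qed.

Lemma tendsD (u v : nat -> A) l l' : tends u l -> tends v l' ->
  tends (fun n => u n + v n) (l + l').
Proof. by rewrite -!tendsP => ul vl; exact: cvgD. Qed.

Lemma tends_mulr (u : nat -> A) l a : tends u l -> tends (fun n => u n * a) (l * a).
Proof.
move=> ul e e0; have a1 : 0 < 1 + rnorm a by rewrite ltr_wpDr ?rnorm_ge0.
have [N HN] := ul (e / (1 + rnorm a)) (divr_gt0 e0 a1).
exists N => n /HN; rewrite ltr_pdivlMr // => h.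
rewrite -mulrBl; apply: le_lt_trans h; apply: le_trans (rnormM _ _) _.
by rewrite ler_wpM2l ?rnorm_ge0 // lerDr.
Qed.

Lemma tends_norm_le (u : nat -> A) l s : tends u l -> (forall n, rnorm (u n) <= s) ->
  rnorm l <= s.
Proof.
move=> ul us; apply/ler_addgt0Pr => d d0; have [N HN] := ul _ d0.
have -> : l = u N - (u N - l) by rewrite subKr.
by apply: le_trans (rnorm_sub _ _) _; rewrite lerD // ltW // HN.
Qed.

Lemma hnorm_ge0 x : 0 <= hnorm x. Proof. exact: sqrtr_ge0. Qed.

Lemma hnorm_sqr x : hnorm x ^+ 2 = rnorm (inner x x).
Proof. by rewrite sqr_sqrtr // rnorm_ge0. Qed.

Lemma pnorm_le_hnorm n x : ell2 x -> pnorm n x <= hnorm x.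
Proof.
move=> xl; rewrite -le_sqr ?pnorm_ge0 ?hnorm_ge0 // pnorm_sqr hnorm_sqr.
apply/ler_addgt0Pr => d d0.
have [N HN] := inner_tends xl xl d0.
have := HN _ (leq_maxl N n); set p := maxn N n => h.
apply: (@le_trans _ _ (rnorm (pinner p x x))).
  by rewrite -!pnorm_sqr le_sqr ?pnorm_ge0 // pnorm_mono // leq_maxr.
rewrite -(subrK (inner x x) (pinner p x x)) addrC.
by apply: le_trans (rnormD _ _) _; rewrite lerD // ltW.
Qed.

(** With [pnorm_le_hnorm], [hnorm] is the supremum of the partial norms; the
inequalities between norms in H_A are all read off from finite sums in this
way. *)
Lemma hnorm_le x s : ell2 x -> (forall n, pnorm n x <= s) -> hnorm x <= s.
Proof.
move=> xl xs; have s0 : 0 <= s := le_trans (pnorm_ge0 0 x) (xs 0%N).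
rewrite -le_sqr ?hnorm_ge0 // hnorm_sqr.
apply: tends_norm_le (inner_tends xl xl) _ => n.
by rewrite -pnorm_sqr le_sqr ?pnorm_ge0.
Qed.

Lemma small_tails_le x y s : (forall n m, pnorm n (tail m y) <= s * pnorm n (tail m x)) ->
  small_tails x -> small_tails y.
Proof.
move=> H sx e e0.
have s1 : 0 < 1 + `|s| by rewrite ltr_wpDr.
have [m Hm] := sx (e / (1 + `|s|)) (divr_gt0 e0 s1).
exists m => n; apply: le_trans (H n m) _.
have := Hm n; rewrite ler_pdivlMr // => h; apply: le_trans h.
rewrite mulrC ler_wpM2l ?pnorm_ge0 //.
by apply: le_trans (ler_norm s) _; rewrite lerDr.
Qed.

Lemma tailD m x y : tail m (x + y) = tail m x + tail m y.
Proof. by apply/funext => k; rewrite !fctE /tail; case: ifP; rewrite ?addr0. Qed.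

Lemma tailN m x : tail m (- x) = - tail m x.
Proof. by apply/funext => k; rewrite /tail !fctE; case: ifP; rewrite ?oppr0. Qed.

Lemma tailB m x y : tail m (x - y) = tail m x - tail m y.
Proof. by rewrite tailD tailN. Qed.

Lemma tail_rmul m x a : tail m (rmul x a) = rmul (tail m x) a.
Proof. by apply/funext => k; rewrite /tail /rmul; case: ifP; rewrite ?mul0r. Qed.

Lemma ell2D x y : ell2 x -> ell2 y -> ell2 (x + y).
Proof.
move=> /ell2P sx /ell2P sy; apply/ell2P => e e0.
have e2 : 0 < e / 2 by rewrite divr_gt0.
have [m Hm] := sx _ e2; have [m' Hm'] := sy _ e2.
exists (maxn m m') => n; rewrite tailD; apply: le_trans (pnormD _ _ _) _.
rewrite [leRHS]splitr; apply: lerD.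
  by apply: le_trans (pnorm_tail_le _ _ (leq_maxl _ _)) (Hm n).
by apply: le_trans (pnorm_tail_le _ _ (leq_maxr _ _)) (Hm' n).
Qed.

Lemma ell2N x : ell2 x -> ell2 (- x).
Proof.
move=> /ell2P sx; apply/ell2P; apply: (small_tails_le (s := 1)) sx => n m.
by rewrite tailN pnormN mul1r.
Qed.

Lemma ell2B x y : ell2 x -> ell2 y -> ell2 (x - y).
Proof. by move=> hx hy; apply: ell2D => //; exact: ell2N. Qed.

Lemma ell2_rmul x a : ell2 x -> ell2 (rmul x a).
Proof.
move=> /ell2P sx; apply/ell2P; apply: (small_tails_le (s := rnorm a)) sx => n m.
by rewrite tail_rmul mulrC pnorm_rmul.
Qed.

Lemma tail_comm m m' x : tail m (tail m' x) = tail m' (tail m x).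
Proof.
by apply/funext => k; rewrite /tail; case: (k < m)%N; case: (k < m')%N.
Qed.

Lemma tailK m x : tail m (tail m x) = tail m x.
Proof. exact: tail_tail. Qed.

Lemma ell2_tail m x : ell2 x -> ell2 (tail m x).
Proof.
move=> /ell2P sx; apply/ell2P; apply: (small_tails_le (s := 1)) sx => n m'.
by rewrite mul1r tail_comm pnorm_tail.
Qed.

Lemma ell2_0 : ell2 (0 : A ^nat).
Proof.
apply/ell2P => e e0; exists 0%N => n; rewrite /pnorm /pinner big1 ?rnorm0 ?sqrtr0 ?ltW //.
by move=> k _; rewrite /tail mulr0.
Qed.

Lemma ell2_sum (I : Type) (r : seq I) (P : pred I) (F : I -> A ^nat) :
  (forall i, P i -> ell2 (F i)) -> ell2 (\sum_(i <- r | P i) F i).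
Proof. by move=> F0; elim/big_ind: _ => //; [exact: ell2_0|exact: ell2D]. Qed.

Lemma hnormD x y : ell2 x -> ell2 y -> hnorm (x + y) <= hnorm x + hnorm y.
Proof.
move=> hx hy; apply: hnorm_le => [|n]; first exact: ell2D.
by apply: le_trans (pnormD _ _ _) _; rewrite lerD // pnorm_le_hnorm.
Qed.

Lemma hnormN x : hnorm (- x) = hnorm x.
Proof.
rewrite /hnorm /inner; congr (Num.sqrt (rnorm (limn (series _)))).
by apply/funext => k; rewrite fctE starN mulrNN.
Qed.

Lemma hnormB x y : ell2 x -> ell2 y -> hnorm (x - y) <= hnorm x + hnorm y.
Proof. by move=> hx hy; rewrite -(hnormN y) hnormD //; exact: ell2N. Qed.

Lemma hnormBC x y : hnorm (x - y) = hnorm (y - x).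
Proof. by rewrite -opprB hnormN. Qed.

Lemma hnorm_rmul x a : ell2 x -> hnorm (rmul x a) <= hnorm x * rnorm a.
Proof.
move=> hx; apply: hnorm_le => [|n]; first exact: ell2_rmul.
by apply: le_trans (pnorm_rmul _ _ _) _; rewrite ler_wpM2r ?rnorm_ge0 ?pnorm_le_hnorm.
Qed.

Lemma hnorm_tail m x : ell2 x -> hnorm (tail m x) <= hnorm x.
Proof.
move=> hx; apply: hnorm_le => [|n]; first exact: ell2_tail.
by apply: le_trans (pnorm_tail _ _ _) _; rewrite pnorm_le_hnorm.
Qed.

Lemma tail_to0 x e : ell2 x -> 0 < e ->
  exists M, forall m, (M <= m)%N -> hnorm (tail m x) <= e.
Proof.
move=> hx e0; have /ell2P/(_ _ e0)[M HM] := hx.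
exists M => m Mm; apply: hnorm_le => [|n]; first exact: ell2_tail.
by apply: le_trans (pnorm_tail_le _ _ Mm) _.
Qed.

Lemma hnorm_coord k x : ell2 x -> rnorm (x k) <= hnorm x.
Proof. by move=> hx; apply: le_trans (pnorm_coord _ (leqnn _)) (pnorm_le_hnorm _ hx). Qed.

Lemma hnorm_eq0 x : ell2 x -> hnorm x <= 0 -> x = 0.
Proof.
move=> hx x0; apply/funext => k; apply: rnorm_eq0; apply/eqP.
by rewrite eq_le rnorm_ge0 andbT (le_trans (hnorm_coord k hx)).
Qed.

Lemma hnorm0 : hnorm (0 : A ^nat) = 0.
Proof.
apply/eqP; rewrite eq_le hnorm_ge0 andbT; apply: hnorm_le ell2_0 _ => n.
by rewrite /pnorm /pinner big1 ?rnorm0 ?sqrtr0 // => k _; rewrite mulr0.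
Qed.

Lemma inner_CS x y : ell2 x -> ell2 y -> rnorm (inner x y) <= hnorm x * hnorm y.
Proof.
move=> hx hy; apply: tends_norm_le (inner_tends hx hy) _ => n.
by apply: le_trans (pinner_CS _ _ _) _; rewrite ler_pM ?pnorm_ge0 ?pnorm_le_hnorm.
Qed.

Lemma innerDr x y z : ell2 x -> ell2 y -> ell2 z ->
  inner x (y + z) = inner x y + inner x z.
Proof.
move=> hx hy hz; apply: tends_unique (inner_tends hx (ell2D hy hz)) _.
have := tendsD (inner_tends hx hy) (inner_tends hx hz).
by congr tends; apply/funext => n; rewrite pinnerDr.
Qed.

Lemma inner_rmul x y a : ell2 x -> ell2 y -> inner x (rmul y a) = inner x y * a.
Proof.
move=> hx hy; apply: tends_unique (inner_tends hx (ell2_rmul hy)) _.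
have := tends_mulr a (inner_tends hx hy).
by congr tends; apply/funext => n; rewrite pinner_rmulr.
Qed.

Lemma inner_tail m x y : inner x (tail m y) = inner (tail m x) y.
Proof.
congr (limn (series _)); apply/funext => k; rewrite /tail.
by case: ifP; rewrite ?star0 ?mul0r ?mulr0.
Qed.

Lemma rmulDl x y a : rmul (x + y) a = rmul x a + rmul y a.
Proof. by apply/funext => k; rewrite /rmul !fctE mulrDl. Qed.
Lemma rmulNl x a : rmul (- x) a = - rmul x a.
Proof. by apply/funext => k; rewrite /rmul !fctE mulNr. Qed.
Lemma rmulDr x a b : rmul x (a + b) = rmul x a + rmul x b.
Proof. by apply/funext => k; rewrite /rmul !fctE mulrDr. Qed.
Lemma rmulA x a b : rmul (rmul x a) b = rmul x (a * b).
Proof. by apply/funext => k; rewrite /rmul mulrA. Qed.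
Lemma rmul1 x : rmul x 1 = x.
Proof. by apply/funext => k; rewrite /rmul mulr1. Qed.
Lemma rmul0 x : rmul x 0 = 0.
Proof. by apply/funext => k; rewrite /rmul mulr0. Qed.
Lemma rmul0l a : rmul (0 : A ^nat) a = 0.
Proof. by apply/funext => k; rewrite /rmul mul0r. Qed.

Definition hscale t x := rmul x (t%:C *: (1 : A)).

Lemma hscaleE t x k : hscale t x k = t%:C *: x k.
Proof. by rewrite /hscale /rmul scale_mulr mulr1. Qed.

Lemma hscaleK t x : t != 0 -> hscale t (hscale t^-1 x) = x.
Proof.
by move=> t0; apply/funext => k; rewrite !hscaleE real_scaleA divff // real_scale1.
Qed.

Lemma hnorm_scale t x : ell2 x -> hnorm (hscale t x) <= `|t| * hnorm x.
Proof.
move=> hx; apply: le_trans (hnorm_rmul _ hx) _; rewrite mulrC.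
by rewrite ler_wpM2r ?hnorm_ge0 // rnormZ ler_piMr // rnorm1.
Qed.

(** The limit is taken coordinatewise.  For a fixed number p of coordinates the
partial norm of u n - x is a limit of those of u n - u m, hence bounded
independently of p, which puts x in H_A and makes the convergence one in
norm. *)
Lemma ell2_complete (u : nat -> A ^nat) : (forall n, ell2 (u n)) ->
  (forall e, 0 < e -> exists N, forall m n, (N <= m)%N -> (N <= n)%N ->
     hnorm (u m - u n) <= e) ->
  exists x, ell2 x /\ forall e, 0 < e -> exists N, forall n, (N <= n)%N ->
     hnorm (u n - x) <= e.
Proof.
move=> hu cu.
have /choice[x hx] k : exists l, tends (fun n => u n k) l.
  apply: rnorm_complete => e e0.
  have [|N HN] := cu (e / 2); first by rewrite divr_gt0.
  exists N => m n Nm Nn.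
  apply: (@le_lt_trans _ _ (e / 2)); last by rewrite ltr_pdivrMr // ltr_pMr // ltr1n.
  apply: le_trans (HN _ _ Nm Nn).
  by have := hnorm_coord k (ell2B (hu m) (hu n)); rewrite !fctE.
have fin_cvg p : tends (fun n => pinner p (u n - x) (u n - x)) 0.
  elim: p => [|p IH].
    move=> e e0; exists 0%N => n _; rewrite /pinner big_geq // subr0 rnorm0 //.
  rewrite -[0]addr0; have {}IH := tendsD IH.
  suff /IH : tends (fun n => star ((u n - x) p) * (u n - x) p) 0.
    by congr tends; apply/funext => n; rewrite /pinner [in RHS]big_nat_recr.
  move=> e e0; have [|N HN] := hx p (Num.sqrt e); first by rewrite sqrtr_gt0.
  exists N => n /HN h; rewrite subr0 rnorm_star_mul -(sqr_sqrtr (ltW e0)).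
  by rewrite ltr_pXn2r // ?nnegrE ?rnorm_ge0 ?sqrtr_ge0.
have key e : 0 < e -> exists N, forall n, (N <= n)%N -> forall p, pnorm p (u n - x) <= e.
  move=> e0; have e2 : 0 < e / 2 by rewrite divr_gt0.
  have [N HN] := cu _ e2; exists N => n Nn p.
  have [|M HM] := fin_cvg p ((e / 2) ^+ 2); first by rewrite exprn_gt0.
  set m := maxn N M.
  have -> : u n - x = (u n - u m) + (u m - x) by rewrite addrA subrK.
  apply: le_trans (pnormD _ _ _) _; rewrite [leRHS]splitr; apply: lerD.
    apply: le_trans (pnorm_le_hnorm _ (ell2B (hu _) (hu _))) _.
    by apply: HN => //; exact: leq_maxl.
  rewrite -le_sqr ?pnorm_ge0 ?(ltW e2) // pnorm_sqr ltW //.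
  by have := HM m (leq_maxr _ _); rewrite subr0.
have xl : ell2 x.
  apply/ell2P => e e0; have e2 : 0 < e / 2 by rewrite divr_gt0.
  have [N HN] := key _ e2; have /ell2P/(_ _ e2)[M HM] := hu N.
  exists M => p; have -> : tail M x = tail M (u N) - tail M (u N - x).
    by rewrite -tailB subKr.
  apply: le_trans (pnormD _ _ _) _; rewrite [leRHS]splitr lerD // pnormN.
  by apply: le_trans (pnorm_tail _ _ _) (HN _ _ _).
exists x; split=> // e e0; have [N HN] := key _ e0; exists N => n Nn.
by apply: hnorm_le => [|p]; [exact: ell2B|exact: HN].
Qed.

End StandardModule.

(** * Completeness and category *)

Section Operators.
Context {R : realType} {A : cstarAlgType R}.
Implicit Types (a b c : A) (s t e q : R) (x y z : A ^nat) (m n : nat).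
Implicit Types (M : set (A ^nat)) (T : A ^nat -> A ^nat).

Lemma geom_small t q e : 0 <= q -> q < 1 -> 0 < e -> exists n, t * q ^+ n <= e.
Proof.
move=> q0 q1 e0; have t1 : 0 < 1 + `|t| by rewrite ltr_wpDr.
have qq : `|q| < 1 by rewrite ger0_norm.
have [N _ HN] : \forall n \near \oo, `|0 - q ^+ n| < e / (1 + `|t|).
  by apply: (@cvgr_dist_lt _ R^o _ _ _ _ _ (cvg_expr qq)); rewrite divr_gt0.
exists N; have := HN N (leqnn _); rewrite /= sub0r normrN normrX (ger0_norm q0).
rewrite ltr_pdivlMr // => /ltW; apply: le_trans; rewrite mulrC ler_wpM2l ?exprn_ge0 //.
by apply: le_trans (ler_norm t) _; rewrite lerDr.
Qed.

Lemma hnorm_dist x y z : ell2 x -> ell2 y -> ell2 z ->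
  hnorm (x - z) <= hnorm (x - y) + hnorm (y - z).
Proof.
move=> hx hy hz; rewrite -(subrKA y x (- z)); apply: hnormD; exact: ell2B.
Qed.

(** The nested balls of [baire], the iteration of [neumann] and the successive
approximations of [direct_sum_projection] all need the limit together with the
distance to it. *)
Lemma ell2_cvg_majorant (u : nat -> A ^nat) (r : nat -> R) :
  (forall n, ell2 (u n)) -> (forall n, 0 <= r n) ->
  (forall n, hnorm (u n.+1 - u n) <= r n - r n.+1) ->
  (forall e, 0 < e -> exists N, r N <= e) ->
  exists2 x, ell2 x & forall n, hnorm (u n - x) <= r n.
Proof.
move=> hu r0 step small.
have dist n m : (n <= m)%N -> hnorm (u m - u n) <= r n - r m.
  move=> /subnK <-; elim: (m - n)%N => [|d IH]; first by rewrite add0n !subrr hnorm0.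
  rewrite addSn.
  apply: le_trans (hnorm_dist (hu _) (hu (d + n)%N) (hu _)) _.
  by apply: le_trans (lerD (step _) IH) _; rewrite addrC addrA subrK.
have distr n m : (n <= m)%N -> hnorm (u m - u n) <= r n.
  by move=> nm; apply: le_trans (dist _ _ nm) _; rewrite gerBl.
have [|x [hx xu]] := @ell2_complete _ _ u hu.
  move=> e e0; have [N HN] := small (e / 2) (divr_gt0 e0 (ltr0n _ 2)).
  exists N => m n Nm Nn.
  apply: le_trans (hnorm_dist (hu _) (hu N) (hu _)) _.
  by rewrite [leRHS]splitr lerD // (le_trans _ HN) // ?distr // hnormBC distr.
exists x => // n; apply/ler_addgt0Pr => e e0; have [N HN] := xu _ e0.
apply: le_trans (hnorm_dist (hu _) (hu (maxn n N)) hx) _.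
apply: lerD; last by apply: HN; exact: leq_maxr.
by rewrite hnormBC; apply: distr; exact: leq_maxl.
Qed.

Lemma ell2_closed_submodule : closed_submodule (@ell2 R A).
Proof.
split=> //; [exact: ell2_0|exact: ell2D|by move=> x a; exact: ell2_rmul].
Qed.

Lemma csub_opp M x : closed_submodule M -> M x -> M (- x).
Proof.
case=> _ _ _ Mr _ Mx; have := Mr x (-1) Mx; congr M.
by apply/funext => k; rewrite /rmul fctE mulrN1.
Qed.

Lemma csub_sub M x y : closed_submodule M -> M x -> M y -> M (x - y).
Proof. by move=> cM Mx My; case: (cM) => _ _ MD _ _; apply: MD => //; exact: csub_opp. Qed.

Lemma csub_lim M (u : nat -> A ^nat) (r : nat -> R) x :
  closed_submodule M -> (forall n, M (u n)) -> ell2 x ->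
  (forall n, hnorm (u n - x) <= r n) -> (forall e, 0 < e -> exists N, r N <= e) -> M x.
Proof.
case=> _ _ _ _ Mc Mu hx ux small; apply: Mc => // e e0.
have [N HN] := small (e / 2) (divr_gt0 e0 (ltr0n _ 2)).
exists (u N) => //; rewrite hnormBC; apply: le_lt_trans (ux N) _.
by apply: le_lt_trans HN _; rewrite ltr_pdivrMr // ltr_pMr // ltr1n.
Qed.

(** Otherwise every ball of M contains a smaller one that stays away from C k, and
such balls, nested for k = 0, 1, 2 and so on, shrink to a point of M outside
every C k. *)
Lemma baire M (C : nat -> set (A ^nat)) : closed_submodule M ->
  (forall x, M x -> exists k, C k x) ->
  exists k x0 r, [/\ M x0, 0 < r & forall x, M x -> hnorm (x - x0) <= r ->
    forall e, 0 < e -> exists2 y, C k y & hnorm (x - y) <= e].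
Proof.
move=> cM cov; apply: contrapT => H.
have Ml : M `<=` ell2 by case: cM.
have M0 : M 0 by case: cM.
have /choice[next Hn] (p : nat * (A ^nat * R)) : exists v : A ^nat * R,
    M p.2.1 -> 0 < p.2.2 -> [/\ M v.1, 0 < v.2,
      hnorm (v.1 - p.2.1) <= p.2.2 / 2, v.2 <= p.2.2 / 2 &
      forall y, C p.1 y -> v.2 < hnorm (v.1 - y)].
  case: p => k [x0 r] /=; have [Mx0|nM] := pselect (M x0); last by exists (0, 0).
  have [r0|nr] := ltrP 0 r; last by exists (0, 0).
  apply: contrapT => Hk; apply: H; exists k, x0, (r / 2); split=> //.
    by rewrite divr_gt0.
  move=> x Mx xr e e0; apply: contrapT => He; apply: Hk.
  exists (x, Num.min e (r / 2)) => _ _ /=; split=> //.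
  - by rewrite lt_min e0 divr_gt0.
  - by rewrite ge_min lexx orbT.
  - move=> y Cy; rewrite ltNge; apply/negP => h; apply: He; exists y => //.
    by apply: le_trans h _; rewrite ge_min lexx.
pose st := fix st n := match n with 0%N => (0, 1) | n.+1 => next (n, st n) end.
have inv n : M (st n).1 /\ 0 < (st n).2.
  by elim: n => [|n [IM I0]] //=; have [] := Hn (n, st n) IM I0.
have stS n := Hn (n, st n) (inv n).1 (inv n).2.
have rn n : (st n).2 <= 2^-1 ^+ n.
  elim: n => [|n IH] //; have [_ _ _ h _] := stS n.
  by apply: le_trans h _; rewrite exprSr ler_pM2r ?invr_gt0.
have small e : 0 < e -> exists N, (st N).2 <= e.
  move=> e0; have [||n] := @geom_small 1 2^-1 e _ _ e0; first by rewrite invr_ge0.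
    by rewrite invf_lt1 // ltr1n.
  by rewrite mul1r => h; exists n; exact: le_trans (rn n) h.
have [||||x hx ux] := @ell2_cvg_majorant (fun n => (st n).1) (fun n => (st n).2).
- by move=> n; apply/Ml; have [] := inv n.
- by move=> n; apply/ltW; have [] := inv n.
- move=> n; have [_ _ h1 h2 _] := stS n; apply: le_trans h1 _.
  by move: h2 => /=; lra.
- exact: small.
have Mx : M x by apply: (csub_lim cM _ hx ux small) => n; have [] := inv n.
have [k Ckx] := cov _ Mx.
have [_ _ _ _ /(_ _ Ckx)] := stS k.
by rewrite ltNge => /negP; apply; exact: (ux k.+1).
Qed.

Lemma hscaleB t x y : hscale t (x - y) = hscale t x - hscale t y.
Proof. by rewrite /hscale rmulDl rmulNl. Qed.

Lemma hscaleVK t x : t != 0 -> hscale t^-1 (hscale t x) = x.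
Proof.
by move=> t0; apply/funext => k; rewrite !hscaleE real_scaleA mulVf // real_scale1.
Qed.

(** The density half of the open mapping theorem, for a family C of gauge balls
instead of a linear map: it is used for the sums of two submodules and for the
combinations of finitely many generators. *)
Lemma almost_open M (C : R -> set (A ^nat)) : closed_submodule M ->
  (forall s x, C s x -> ell2 x) ->
  (forall s t x y, C s x -> C t y -> C (s + t) (x - y)) ->
  (forall s t x, 0 < t -> C s x -> C (t * s) (hscale t x)) ->
  (forall x, M x -> exists k : nat, C k%:R x) ->
  exists2 s, 0 <= s & forall x t e, M x -> 0 < t -> hnorm x <= t -> 0 < e ->
    exists2 y, C (s * t) y & hnorm (x - y) <= e.
Proof.
move=> cM Cl CB Cs cov.
have [k [x0 [r [Mx0 r0 Hk]]]] := baire (C := fun k => C k%:R) cM cov.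
have [Ml M0 MD Mr _] := cM.
exists (r^-1 * (k%:R + k%:R)) => [|x t e Mx t0 xt e0].
  by rewrite mulr_ge0 ?addr_ge0 // invr_ge0 ltW.
have rt : 0 < r / t by rewrite divr_gt0.
pose x' := hscale (r / t) x.
have Mx' : M x' by exact: Mr.
pose e' := (r / t) * (e / 2).
have e'0 : 0 < e' by rewrite mulr_gt0 // divr_gt0.
have [|y1 Cy1 h1] := Hk (x0 + x') (MD _ _ Mx0 Mx') _ _ e'0.
  rewrite addrC addKr; apply: le_trans (hnorm_scale _ (Ml _ Mx)) _.
  rewrite gtr0_norm // -[leRHS](divfK (lt0r_neq0 t0)) ler_pM2l //.
have [|y2 Cy2 h2] := Hk x0 Mx0 _ _ e'0; first by rewrite subrr hnorm0 ltW.
have l1 := Cl _ _ Cy1; have l2 := Cl _ _ Cy2.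
exists (hscale (r / t)^-1 (y1 - y2)).
  have -> : r^-1 * (k%:R + k%:R) * t = (r / t)^-1 * (k%:R + k%:R).
    by rewrite invf_div mulrAC [t / r]mulrC.
  by apply: Cs; [rewrite invr_gt0|exact: CB].
have -> : x - hscale (r / t)^-1 (y1 - y2) =
    hscale (r / t)^-1 (((x0 + x') - y1) - (x0 - y2)).
  have -> : x0 + x' - y1 - (x0 - y2) = x' - (y1 - y2).
    rewrite !opprB [x0 + x']addrC [x' + x0 - y1]addrAC [y2 - x0]addrC addrA addrK.
    by rewrite addrA addrAC.
  by rewrite [in RHS]hscaleB /x' hscaleVK // gt_eqF.
have l0 := Ml _ Mx0; have l' := Ml _ Mx'.
apply: le_trans (hnorm_scale _ _) _.
  by apply: ell2B; apply: ell2B => //; exact: ell2D.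
rewrite gtr0_norm ?invr_gt0 // mulrC ler_pdivrMr //.
apply: le_trans (hnormB _ _) _; [by apply: ell2B => //; exact: ell2D|exact: ell2B|].
apply: le_trans (lerD h1 h2) _; rewrite /e' -mulrDr -splitr mulrC //.
Qed.

End Operators.

(** * Bounded operators and projections *)

Section Bounded.
Context {R : realType} {A : cstarAlgType R}.
Implicit Types (a b c : A) (s t e q : R) (x y z : A ^nat) (m n : nat).
Implicit Types (M : set (A ^nat)) (T S F : A ^nat -> A ^nat).

(** Bounded A-linear maps of H_A, without an adjoint: neither the projections of a
non-orthogonal direct sum nor the inverses of isomorphisms need have one. *)
Definition Bop T := [/\ set_fun ell2 ell2 T, Alinear_on ell2 T & bounded_map_on ell2 T].

Lemma bounded_gt0 M T : bounded_map_on M T ->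
  exists2 s, 0 < s & forall x, M x -> hnorm (T x) <= s * hnorm x.
Proof.
case=> s hs; exists (1 + `|s|) => [|x Mx]; first by rewrite ltr_wpDr.
apply: le_trans (hs _ Mx) _; rewrite ler_wpM2r ?hnorm_ge0 //.
by apply: le_trans (ler_norm s) _; rewrite lerDr.
Qed.

Lemma BopE T x : Bop T -> ell2 x -> ell2 (T x).
Proof. by case=> Te _ _; exact: Te. Qed.

Lemma BopD T x y : Bop T -> ell2 x -> ell2 y -> T (x + y) = T x + T y.
Proof. by case=> _ [TD _] _; exact: TD. Qed.

Lemma Bop_rmul T x a : Bop T -> ell2 x -> T (rmul x a) = rmul (T x) a.
Proof. by case=> _ [_ Tr] _; exact: Tr. Qed.

Lemma Bop0 T : Bop T -> T 0 = 0.
Proof. by move=> hT; have := Bop_rmul 0 hT ell2_0; rewrite !rmul0. Qed.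

Lemma BopN T x : Bop T -> ell2 x -> T (- x) = - T x.
Proof.
move=> hT hx; apply: (@addrI _ (T x)); rewrite -(BopD hT) ?subrr ?(Bop0 hT) //.
exact: ell2N.
Qed.

Lemma BopB T x y : Bop T -> ell2 x -> ell2 y -> T (x - y) = T x - T y.
Proof. by move=> hT hx hy; rewrite (BopD hT) ?(BopN hT) //; exact: ell2N. Qed.

Lemma Bop_bound T : Bop T ->
  exists2 s, 0 < s & forall x, ell2 x -> hnorm (T x) <= s * hnorm x.
Proof. by case=> _ _; exact: bounded_gt0. Qed.

Lemma Bop_comp T S : Bop T -> Bop S -> Bop (fun x => T (S x)).
Proof.
move=> hT hS; split.
- by move=> x hx; apply/BopE/BopE.
- split=> [x y hx hy|x a hx].
    by rewrite (BopD hS) // (BopD hT) //; exact: BopE.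
  by rewrite (Bop_rmul _ hS) // (Bop_rmul _ hT) //; exact: BopE.
- have [s s0 Hs] := Bop_bound hT; have [t t0 Ht] := Bop_bound hS.
  exists (s * t) => x hx; apply: le_trans (Hs _ (BopE hS hx)) _.
  by rewrite -mulrA ler_pM2l //; exact: Ht.
Qed.

Lemma Bop_add T S : Bop T -> Bop S -> Bop (fun x => T x + S x).
Proof.
move=> hT hS; split.
- by move=> x hx; apply: ell2D; exact: BopE.
- split=> [x y hx hy|x a hx].
    by rewrite (BopD hS) // (BopD hT) // addrACA.
  by rewrite (Bop_rmul _ hS) // (Bop_rmul _ hT) // rmulDl.
- have [s s0 Hs] := Bop_bound hT; have [t t0 Ht] := Bop_bound hS.
  exists (s + t) => x hx; apply: le_trans (hnormD (BopE hT hx) (BopE hS hx)) _.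
  by rewrite mulrDl; apply: lerD; [exact: Hs|exact: Ht].
Qed.

Lemma Bop_opp T : Bop T -> Bop (fun x => - T x).
Proof.
move=> hT; split.
- by move=> x hx; apply: ell2N; exact: BopE.
- split=> [x y hx hy|x a hx].
    by rewrite (BopD hT) // opprD.
  by rewrite (Bop_rmul _ hT) // rmulNl.
- have [s s0 Hs] := Bop_bound hT.
  by exists s => x hx; rewrite hnormN; exact: Hs.
Qed.

Lemma Bop_sub T S : Bop T -> Bop S -> Bop (fun x => T x - S x).
Proof. by move=> hT hS; apply: Bop_add => //; exact: Bop_opp. Qed.

Lemma Bop_id : Bop id.
Proof. by split=> //; exists 1 => x _; rewrite mul1r. Qed.

Lemma Bop_tail m : Bop (tail m).
Proof.
split.
- by move=> x hx; exact: ell2_tail.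
- by split=> [x y _ _|x a _]; [exact: tailD|exact: tail_rmul].
- by exists 1 => x hx; rewrite mul1r hnorm_tail.
Qed.

Lemma Ba_Bop T : Ba T -> Bop T.
Proof. by case. Qed.

(** x + T x = y is solved by iterating x := y - T x.  The lower bound
(1 - q) |x| <= |x + T x| makes the solution unique, and uniqueness makes it
A-linear in y. *)
Lemma neumann T q : Bop T -> 0 <= q -> q < 1 ->
  (forall x, ell2 x -> hnorm (T x) <= q * hnorm x) ->
  exists V, [/\ Bop V, forall x, ell2 x -> V x + T (V x) = x,
    forall x, ell2 x -> V (x + T x) = x &
    forall x, ell2 x -> hnorm (V x) <= (1 - q)^-1 * hnorm x].
Proof.
move=> hT q0 q1 Tq.
have q1' : 0 < 1 - q by rewrite subr_gt0.
have lower x : ell2 x -> (1 - q) * hnorm x <= hnorm (x + T x).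
  move=> hx; rewrite mulrBl mul1r lerBlDr.
  apply: le_trans (lerD (lexx _) (Tq _ hx)).
  rewrite -{1}[x](addrK (T x)); apply: hnormB; last exact: BopE.
  by apply: ell2D => //; exact: BopE.
have inj x y : ell2 x -> ell2 y -> x + T x = y + T y -> x = y.
  move=> hx hy e; apply/eqP; rewrite -subr_eq0; apply/eqP.
  have hxy := ell2B hx hy.
  apply: hnorm_eq0 => //; rewrite -(ler_pM2l q1') mulr0.
  apply: le_trans (lower _ hxy) _.
  by rewrite (BopB hT) // addrACA -opprD e subrr hnorm0.
have surj y : exists x, ell2 y -> ell2 x /\ x + T x = y.
  have [hy|nhy] := pselect (ell2 y); last by exists 0.
  pose u n := iter n (fun x => y - T x) 0.
  have hu n : ell2 (u n).
    elim: n => [|n IH]; first exact: ell2_0.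
    by apply: ell2B => //; exact: BopE.
  pose K := (1 - q)^-1 * hnorm y.
  have K0 : 0 <= K by rewrite mulr_ge0 ?hnorm_ge0 ?invr_ge0 ?ltW.
  have small e : 0 < e -> exists n, K * q ^+ n <= e by move=> e0; exact: geom_small.
  have step n : hnorm (u n.+1 - u n) <= hnorm y * q ^+ n.
    elim: n => [|n IH]; first by rewrite /u /= (Bop0 hT) !subr0 mulr1.
    have -> : u n.+2 - u n.+1 = - (T (u n.+1 - u n)).
      transitivity ((y - T (u n.+1)) - (y - T (u n))) => //.
      by rewrite (BopB hT) // !opprB addrC subrKA.
    rewrite hnormN; apply: le_trans (Tq _ (ell2B (hu _) (hu _))) _.
    by rewrite exprS mulrCA ler_wpM2l.
  have [|||x hx ux] := @ell2_cvg_majorant _ _ u (fun n => K * q ^+ n) hu.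
  - by move=> n; rewrite mulr_ge0 // exprn_ge0.
  - move=> n; apply: le_trans (step n) _; rewrite -mulrBr exprS -{2}[q ^+ n]mul1r -mulrBl.
    by rewrite /K mulrACA mulVf ?gt_eqF // mul1r.
  - exact: small.
  exists x => _; split=> //; apply/eqP; rewrite -subr_eq0; apply/eqP.
  apply: hnorm_eq0; first by apply: ell2B => //; apply: ell2D => //; exact: BopE.
  apply: (@le_eps_mul _ _ _ 2) => d d0; rewrite add0r.
  have [n Hn] := small _ d0.
  have -> : x + T x - y = (T (x - u n)) - (u n.+1 - x).
    transitivity (T (x - u n) - ((y - T (u n)) - x)) => //.
    by rewrite (BopB hT) // !opprB [RHS]addrCA subrKA addrA.
  apply: le_trans (hnormB (BopE hT (ell2B hx (hu _))) (ell2B (hu _) hx)) _.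
  rewrite [d * 2]mulr_natr mulr2n; apply: lerD.
    apply: le_trans (Tq _ (ell2B hx (hu n))) _; rewrite hnormBC.
    apply: le_trans Hn; apply: le_trans (ux n).
    by rewrite ler_piMl ?hnorm_ge0 // ltW.
  apply: le_trans (ux n.+1) _; apply: le_trans Hn.
  by rewrite exprS mulrCA; apply: ler_piMl; [rewrite mulr_ge0 // exprn_ge0|exact: ltW].
have [V HV] := choice surj.
have Vl x : ell2 x -> ell2 (V x) by move=> /HV[].
have VE x : ell2 x -> V x + T (V x) = x by move=> /HV[].
have bV x : ell2 x -> hnorm (V x) <= (1 - q)^-1 * hnorm x.
  move=> hx; rewrite mulrC ler_pdivlMr // mulrC -{2}(VE _ hx); exact/lower/Vl.
exists V; split=> //; last first.
  move=> x hx; apply: inj => //; last by apply: VE; apply: ell2D => //; exact: BopE.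
  by apply: Vl; apply: ell2D => //; exact: BopE.
split=> //; last by exists (1 - q)^-1.
split=> [x y hx hy|x a hx].
  have [lx ly] := (Vl _ hx, Vl _ hy).
  apply: inj; [by apply/Vl/ell2D|exact: ell2D|].
  by rewrite VE ?(BopD hT) //; [rewrite addrACA !VE|exact: ell2D].
have lx := Vl _ hx.
apply: inj; [by apply/Vl/ell2_rmul|exact: ell2_rmul|].
by rewrite VE ?(Bop_rmul _ hT) //; [rewrite -rmulDl VE|exact: ell2_rmul].
Qed.

(** The open mapping theorem for the addition of M and L.  By [almost_open] every
residual is, up to half its size, a sum of elements of M and L of comparable
norm; the corrections sum to an exact decomposition, bounded by the norm of the
element decomposed, and the decomposition is unique. *)
Lemma direct_sum_projection M (L : set (A ^nat)) : direct_sum M L ->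
  exists P, [/\ Bop P, forall x, ell2 x -> M (P x) /\ L (x - P x),
    forall x, M x -> P x = x & forall x, L x -> P x = 0].
Proof.
move=> [cM cL ML0 MLe].
have Ml : M `<=` ell2 by case: cM.
have Ll : L `<=` ell2 by case: cL.
have [_ M0 MD Mr _] := cM; have [_ L0 LD Lr _] := cL.
have uniq x y x' y' : M x -> L y -> M x' -> L y' -> x + y = x' + y' -> x = x'.
  move=> Mx Ly Mx' Ly' e; apply/eqP; rewrite -subr_eq0; apply/eqP.
  have : (M `&` L) (x - x').
    split; first exact: csub_sub.
    suff -> : x - x' = y' - y by exact: csub_sub.
    by apply/eqP; rewrite subr_eq addrAC eq_sym subr_eq addrC e addrC.
  by rewrite ML0.
pose C s := [set x | exists2 x1, M x1 & exists2 x2, L x2 &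
   [/\ hnorm x1 <= s, hnorm x2 <= s & x = x1 + x2]].
have [||||k k0 Hk] := @almost_open _ _ ell2 C ell2_closed_submodule.
- by move=> s _ [x1 M1 [x2 L2 [_ _ ->]]]; apply: ell2D; [exact: Ml|exact: Ll].
- move=> s t _ _ [x1 M1 [x2 L2 [h1 h2 ->]]] [y1 N1 [y2 K2 [h1' h2' ->]]].
  exists (x1 - y1); first exact: csub_sub.
  exists (x2 - y2); first exact: csub_sub.
  split; last by rewrite opprD addrACA.
    by apply: le_trans (hnormB (Ml _ M1) (Ml _ N1)) _; rewrite lerD.
  by apply: le_trans (hnormB (Ll _ L2) (Ll _ K2)) _; rewrite lerD.
- move=> s t _ t0 [x1 M1 [x2 L2 [h1 h2 ->]]].
  exists (hscale t x1); first exact: Mr.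
  exists (hscale t x2); first exact: Lr.
  split; last exact: rmulDl.
    apply: le_trans (hnorm_scale _ (Ml _ M1)) _.
    by rewrite gtr0_norm // ler_pM2l.
  apply: le_trans (hnorm_scale _ (Ll _ L2)) _.
  by rewrite gtr0_norm // ler_pM2l.
- move=> x; rewrite -MLe => -[x1 M1 [x2 L2 <-]].
  exists (Num.truncn (hnorm x1 + hnorm x2)).+1; exists x1 => //; exists x2 => //.
  have /ltW h := truncnS_gt (hnorm x1 + hnorm x2).
  split=> //; apply: le_trans h; first by rewrite lerDl hnorm_ge0.
  by rewrite lerDr hnorm_ge0.
have main x t : ell2 x -> 0 < t -> hnorm x <= t ->
    exists2 x1, M x1 & L (x - x1) /\ hnorm x1 <= 2 * k * t.
  move=> hx t0 xt.
  have th n : 0 < t * 2^-1 ^+ n by rewrite mulr_gt0 // exprn_gt0 // invr_gt0.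
  have /choice[next Hn] (p : nat * (A ^nat * A ^nat)) : exists v : A ^nat * A ^nat,
      M p.2.1 -> L p.2.2 -> hnorm (x - (p.2.1 + p.2.2)) <= t * 2^-1 ^+ p.1 ->
      [/\ M v.1, L v.2, hnorm (v.1 - p.2.1) <= k * (t * 2^-1 ^+ p.1),
          hnorm (v.2 - p.2.2) <= k * (t * 2^-1 ^+ p.1) &
          hnorm (x - (v.1 + v.2)) <= t * 2^-1 ^+ p.1.+1].
    case: p => n [p1 p2] /=.
    have [[M1 [L2 h]]|nh] := pselect (M p1 /\ L p2 /\
        hnorm (x - (p1 + p2)) <= t * 2^-1 ^+ n); last first.
      by exists (0, 0) => M1 L2 h; case: nh.
    have lr : ell2 (x - (p1 + p2)).
      by apply: ell2B => //; apply: ell2D; [exact: Ml|exact: Ll].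
    have [y [y1 N1 [y2 K2 [h1 h2 ->]]] hy] := Hk _ _ _ lr (th n) h (th n.+1).
    exists (p1 + y1, p2 + y2) => _ _ _ /=.
    rewrite ![_ + _ - _]addrC !addKr; split=> //; [exact: MD|exact: LD|].
    apply: le_trans hy; rewrite -[X in _ <= hnorm X]addrA -opprD.
    by rewrite [p1 + p2 + _]addrACA.
  pose st := fix st n := match n with 0%N => (0, 0) | n.+1 => next (n, st n) end.
  have inv n : [/\ M (st n).1, L (st n).2 &
      hnorm (x - ((st n).1 + (st n).2)) <= t * 2^-1 ^+ n].
    elim: n => [|n [IM IL Ih]] /=; first by rewrite addr0 subr0 mulr1.
    by have [] := Hn (n, st n) IM IL Ih.
  have stS n : [/\ hnorm ((st n.+1).1 - (st n).1) <= k * (t * 2^-1 ^+ n) &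
                   hnorm ((st n.+1).2 - (st n).2) <= k * (t * 2^-1 ^+ n)].
    by have [h1 h2 h3] := inv n; have [] := Hn (n, st n) h1 h2 h3.
  (* the n-th correction is at most k t / 2^n, which is the step from r n to r (n + 1) *)
pose r n := 2 * k * t * 2^-1 ^+ n.
  have r0 n : 0 <= r n by rewrite !mulr_ge0 // ?exprn_ge0 ?invr_ge0 // ltW.
  have rS n : k * (t * 2^-1 ^+ n) <= r n - r n.+1.
    by rewrite /r exprS; set z := _ ^+ n; lra.
  have half1 : 2^-1 < 1 :> R by rewrite invf_lt1 // ltr1n.
  have small e : 0 < e -> exists n, r n <= e.
    by move=> e0; apply: geom_small => //; rewrite invr_ge0.
  have [||||x1 h1 u1] := @ell2_cvg_majorant _ _ (fun n => (st n).1) r.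
  - by move=> n; apply: Ml; have [] := inv n.
  - exact: r0.
  - by move=> n; apply: le_trans (rS n); have [] := stS n.
  - exact: small.
  have [||||x2 h2 u2] := @ell2_cvg_majorant _ _ (fun n => (st n).2) r.
  - by move=> n; apply: Ll; have [] := inv n.
  - exact: r0.
  - by move=> n; apply: le_trans (rS n); have [] := stS n.
  - exact: small.
  have M1 : M x1 by apply: (csub_lim cM _ h1 u1 small) => n; have [] := inv n.
  have L2 : L x2 by apply: (csub_lim cL _ h2 u2 small) => n; have [] := inv n.
  have xE : x = x1 + x2.
    apply/eqP; rewrite -subr_eq0; apply/eqP; apply: hnorm_eq0.
      by apply: ell2B => //; exact: ell2D.
    apply: (@le_eps_mul _ _ _ 3) => d d0; rewrite add0r.
    have [n1 Hn1] := small _ d0.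
    have [|n2 Hn2] := @geom_small _ t 2^-1 d _ half1 d0; first by rewrite invr_ge0.
    pose n := maxn n1 n2.
    have dec i j (z : R) : 0 <= z -> (i <= j)%N -> z * 2^-1 ^+ j <= z * 2^-1 ^+ i.
      move=> z0 ij; rewrite ler_wpM2l // ler_wiXn2l // ?invr_ge0 //.
      exact: ltW.
    have rn : r n <= d.
      apply: le_trans Hn1; apply: dec; last exact: leq_maxl.
      by rewrite !mulr_ge0 // ltW.
    have tn : t * 2^-1 ^+ n <= d.
      by apply: le_trans Hn2; apply: dec; [exact: ltW|exact: leq_maxr].
    have [Mn Ln hn] := inv n.
    have -> : x - (x1 + x2) = (x - ((st n).1 + (st n).2)) +
        (((st n).1 - x1) + ((st n).2 - x2)).
      by rewrite [_ - x1 + _]addrACA -opprD addrA subrK.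
    have l1 := Ml _ Mn; have l2 := Ll _ Ln.
    apply: le_trans (hnormD _ _) _.
    - by apply: ell2B => //; exact: ell2D.
    - by apply: ell2D; exact: ell2B.
    have -> : d * 3 = d + (d + d) by lra.
    apply: lerD; first exact: le_trans hn tn.
    apply: le_trans (hnormD (ell2B l1 h1) (ell2B l2 h2)) _.
    by apply: lerD; [exact: le_trans (u1 n) rn|exact: le_trans (u2 n) rn].
  exists x1 => //; split; first by rewrite xE addrC addKr.
  by have := u1 0%N; rewrite sub0r hnormN /r mulr1.
have /choice[P HP] x : exists x1, ell2 x -> M x1 /\ L (x - x1).
  have [hx|nx] := pselect (ell2 x); last by exists 0.
  have [||x1 M1 [L1 _]] := main x (hnorm x + 1) hx.
  - by rewrite ltr_wpDl ?hnorm_ge0.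
  - by rewrite lerDl.
  by exists x1.
have PE x x1 : ell2 x -> M x1 -> L (x - x1) -> P x = x1.
  move=> hx M1 L1; have [M2 L2] := HP _ hx.
  by apply: (uniq _ (x - P x) _ (x - x1)) => //; rewrite [LHS]addrC [RHS]addrC !subrK.
exists P; split=> //.
- split.
  + by move=> x hx; apply: Ml; have [] := HP _ hx.
  + split=> [x y hx hy|x a hx].
      have [M1 L1] := HP _ hx; have [M2 L2] := HP _ hy.
      apply: PE; [exact: ell2D|exact: MD|].
      by rewrite opprD addrACA; exact: LD.
    have [M1 L1] := HP _ hx.
    apply: PE; [exact: ell2_rmul|exact: Mr|].
    by rewrite -rmulNl -rmulDl; exact: Lr.
  + exists (2 * k) => x hx; apply/(@le_eps_mul _ _ _ (2 * k)) => d d0.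
    have [||x1 M1 [L1 h1]] := main x (hnorm x + d) hx.
    * by rewrite ltr_wpDl ?hnorm_ge0.
    * by rewrite lerDl ltW.
    by rewrite (PE x x1) //; apply: le_trans h1 _; rewrite mulrDr [d * _]mulrC.
- by move=> x Mx; apply: PE => //; [exact: Ml|rewrite subrr].
- by move=> x Lx; apply: PE => //; [exact: Ll|rewrite subr0].
Qed.

Lemma fin_gen_mem n (g : 'I_n -> A ^nat) i :
  [set \sum_(i < n) rmul (g i) (a i) | a in [set: 'I_n -> A]] (g i).
Proof.
exists (fun j => if j == i then 1 else 0) => //.
rewrite (bigD1 i) //= eqxx rmul1 big1 ?addr0 // => j /negbTE ->.
by rewrite rmul0.
Qed.

(** By [almost_open] elements of M are approximated by combinations of the generators
with coefficients bounded in terms of the norm, and the tails of finitely many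
generators are small together.  Approximation is enough because the tail maps
are contractions. *)
Lemma fin_gen_tail M e : closed_submodule M -> fin_gen M -> 0 < e ->
  exists m0, forall m, (m0 <= m)%N -> forall x, M x -> hnorm (tail m x) <= e * hnorm x.
Proof.
move=> cM [n [g ME]] e0.
have Ml : M `<=` ell2 by case: cM.
have Mg i : M (g i) by rewrite ME; exact: fin_gen_mem.
have lg i := Ml _ (Mg i).
pose C s := [set x | exists2 a : 'I_n -> A, (forall i, rnorm (a i) <= s) &
   x = \sum_(i < n) rmul (g i) (a i)].
have [||||k k0 Hk] := @almost_open _ _ M C cM.
- by move=> s _ [a _ ->]; apply: ell2_sum => i _; exact: ell2_rmul.
- move=> s t _ _ [a ha ->] [b hb ->]; exists (fun i => a i - b i).
    by move=> i; apply: le_trans (rnorm_sub _ _) _; rewrite lerD.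
  rewrite -sumrB; apply: eq_bigr => i _.
  by apply/funext => j; rewrite /rmul !fctE mulrBr.
- move=> s t _ t0 [a ha ->]; exists (fun i => t%:C *: a i).
    by move=> i; rewrite rnormZ gtr0_norm // ler_pM2l.
  rewrite /hscale; elim/big_rec2: _ => [|i u v _ <-]; first by rewrite rmul0l.
  by rewrite rmulDl rmulA scale_mulr mulr1.
- move=> x; rewrite {1}ME => -[a _ <-].
  exists (Num.truncn (\sum_(i < n) rnorm (a i))).+1; exists a => // i.
  apply/ltW/(le_lt_trans _ (truncnS_gt _)).
  by rewrite (bigD1 i) //= lerDl sumr_ge0 // => j _; exact: rnorm_ge0.
(* n generators with coefficients at most k |x| give tails at most n d k |x| <= e |x| *)
pose d := e / (1 + n%:R * k).
have nk : 0 < 1 + n%:R * k by rewrite ltr_wpDr // mulr_ge0.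
have d0 : 0 < d by rewrite divr_gt0.
have /choice[mi Hmi] i : exists p, forall m, (p <= m)%N -> hnorm (tail m (g i)) <= d.
  exact: tail_to0.
exists (\max_(i < n) mi i)%N => m hm x Mx.
have lx := Ml _ Mx.
apply/(@le_eps_mul _ _ _ (e + 1)) => e1 e10.
have [||y [a ha yE] hy] := Hk x (hnorm x + e1) e1 Mx _ _ e10.
- by rewrite ltr_wpDl ?hnorm_ge0.
- by rewrite lerDl ltW.
have ly : ell2 y by rewrite yE; apply: ell2_sum => i _; exact: ell2_rmul.
have -> : tail m x = tail m y + tail m (x - y) by rewrite -tailD addrC subrK.
apply: le_trans (hnormD (ell2_tail ly) (ell2_tail (ell2B lx ly))) _.
have h1 := le_trans (hnorm_tail m (ell2B lx ly)) hy.
apply: (@le_trans _ _ (e * (hnorm x + e1) + e1)); last by lra.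
apply: lerD => //.
have sumle : hnorm (tail m y) <= \sum_(i < n) hnorm (tail m (rmul (g i) (a i))).
  rewrite yE.
  suff : ell2 (\sum_(i < n) rmul (g i) (a i)) /\ hnorm (tail m (\sum_(i < n) rmul (g i) (a i))) <=
    \sum_(i < n) hnorm (tail m (rmul (g i) (a i))) by case.
  elim/big_rec2: _ => [|i u v _ [lu hv]].
    by rewrite (Bop0 (Bop_tail m)) hnorm0; split=> //; exact: ell2_0.
  have lr := ell2_rmul (a := a i) (lg i).
  split; first exact: ell2D.
  rewrite tailD; apply: le_trans (hnormD (ell2_tail lr) (ell2_tail lu)) _.
  by rewrite lerD.
apply: le_trans sumle _.
apply: (@le_trans _ _ (\sum_(i < n) d * (k * (hnorm x + e1)))).
  apply: ler_sum => i _; rewrite tail_rmul.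
  apply: le_trans (hnorm_rmul _ (ell2_tail (lg i))) _.
  apply: ler_pM; rewrite ?hnorm_ge0 ?rnorm_ge0 //.
  by apply: Hmi; apply: leq_trans hm; exact: leq_bigmax.
rewrite sumr_const card_ord -mulr_natl !mulrA; apply: ler_wpM2r.
  by rewrite addr_ge0 ?hnorm_ge0 // ltW.
have -> : n%:R * e / (1 + n%:R * k) * k = e * (n%:R * k / (1 + n%:R * k)).
  by field; exact: lt0r_neq0.
by apply: ler_piMr; [exact: ltW|rewrite ler_pdivrMr // mul1r lerDr].
Qed.

End Bounded.

(** * Decompositions as outer inverses *)

Ltac ell2_tac := repeat match goal with
  | H : ell2 ?x |- ell2 ?x => exact: H
  | |- ell2 (_ - _) => apply: ell2B
  | |- ell2 (_ + _) => apply: ell2D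
  | |- ell2 (- _) => apply: ell2N
  | |- ell2 (rmul _ _) => apply: ell2_rmul
  | |- ell2 (tail _ _) => apply: ell2_tail
  | |- ell2 0 => exact: ell2_0
  | H : Bop ?T |- ell2 (?T _) => apply: (BopE H)
  end.

Section Decomposition.
Context {R : realType} {A : cstarAlgType R}.
Implicit Types (a b c : A) (s t e q : R) (x y z : A ^nat) (m n : nat).
Implicit Types (M N : set (A ^nat)) (T S F D K V E : A ^nat -> A ^nat).

Definition ker T : set (A ^nat) := [set x | ell2 x /\ T x = 0].

(** The relation S F S = S makes S F and F S idempotent. *)
Definition outer_inverse F S :=
  Bop S /\ forall x, ell2 x -> S (F (S x)) = S x.

Lemma hnorm_small_eq0 x s : ell2 x -> (forall d, 0 < d -> hnorm x <= d * s) -> x = 0.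
Proof.
move=> hx H; apply: hnorm_eq0 => //; apply: (@le_eps_mul _ _ _ s) => d d0.
by rewrite add0r; exact: H.
Qed.

Lemma ker0 T : Bop T -> ker T 0.
Proof. by move=> hT; split; [exact: ell2_0|exact: Bop0]. Qed.

Lemma ker_closed T : Bop T -> closed_submodule (ker T).
Proof.
move=> hT; split.
- by move=> x [].
- exact: ker0.
- move=> x y [hx Tx] [hy Ty]; split; first exact: ell2D.
  by rewrite (BopD hT) // Tx Ty addr0.
- move=> x a [hx Tx]; split; first exact: ell2_rmul.
  by rewrite (Bop_rmul _ hT) // Tx rmul0l.
- move=> x hx H; split => //.
  have [s s0 Hs] := Bop_bound hT.
  apply: (@hnorm_small_eq0 _ s); first exact: BopE.
  move=> d d0; have [y [hy Ty] xy] := H _ d0.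
  have -> : T x = T (x - y) by rewrite (BopB hT) // Ty subr0.
  apply: le_trans (Hs _ (ell2B hx hy)) _.
  by rewrite mulrC ler_wpM2r ?ltW.
Qed.

(** S is the projection onto M2 along N2 followed by the inverse of F from M2 to M1;
it is bounded by [direct_sum_projection]. *)
Lemma decomposition_outer F M1 N1 M2 N2 : Bop F ->
  MPhi_decomposition F M1 N1 M2 N2 ->
  exists S, [/\ outer_inverse F S, N1 = ker (fun x => S (F x)) & N2 = ker S].
Proof.
move=> hF [d1 d2 FM FN [[FMD FMr] _ [_ Finj Fsurj] [g gF gb]]].
have [P2 [hP2 P2in P2M P2N]] := direct_sum_projection d2.
have [cM1 cN1 MN1 MNe1] := d1; have [cM2 cN2 MN2 MNe2] := d2.
have M1l : M1 `<=` ell2 by case: cM1.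
have N1l : N1 `<=` ell2 by case: cN1.
have N2l : N2 `<=` ell2 by case: cN2.
have FM1 x : M1 x -> M2 (F x) by move=> Mx; apply: FM; exists x.
have FN1 x : N1 x -> N2 (F x) by move=> Nx; apply: FN; exists x.
pose S x := g (P2 x).
have lift x : ell2 x -> exists2 u, M1 u & F u = P2 x.
  by move=> /P2in [/Fsurj [u Mu uE] _]; exists u.
have SE x u : M1 u -> F u = P2 x -> S x = u by move=> Mu; rewrite /S => <-; exact: gF.
have [s s0 Hs] := bounded_gt0 gb; have [t t0 Ht] := Bop_bound hP2.
have [_ _ M1D M1r _] := cM1.
have hS : Bop S.
  split.
  - by move=> x /lift [u Mu /(SE _ _ Mu) ->]; exact: M1l.
  - split=> [x y hx hy|x a hx].
      have [u Mu uE] := lift _ hx; have [v Mv vE] := lift _ hy.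
      rewrite (SE _ _ Mu uE) (SE _ _ Mv vE); apply: SE; first exact: M1D.
      by rewrite (BopD hF) ?uE ?vE ?(BopD hP2) //; exact: M1l.
    have [u Mu uE] := lift _ hx.
    rewrite (SE _ _ Mu uE); apply: SE; first exact: M1r.
    by rewrite (Bop_rmul _ hF) ?uE ?(Bop_rmul _ hP2) //; exact: M1l.
  - exists (s * t) => x hx; have [M2x _] := P2in _ hx.
    apply: le_trans (Hs _ M2x) _.
    by rewrite -mulrA ler_pM2l //; exact: Ht.
have SM x : M1 x -> S (F x) = x.
  by move=> Mx; apply: SE => //; rewrite P2M //; exact: FM1.
have SN x : N2 x -> S x = 0.
  move=> Nx; apply: SE; first by case: cM1.
  by rewrite P2N // Bop0.
have SM1 x : ell2 x -> M1 (S x).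
  by move=> /lift [u Mu /(SE _ _ Mu) ->].
have FS x : ell2 x -> F (S x) = P2 x.
  by move=> /lift [u Mu uE]; rewrite (SE _ _ Mu uE).
exists S; split.
- by split=> // x hx; apply: SM; exact: SM1.
- apply/seteqP; split=> x.
    by move=> Nx; split; [exact: N1l|apply: SN; exact: FN1].
  case=> hx; move: (hx); rewrite -MNe1 => -[u Mu [v Nv <-]].
  have [lu lv] := (M1l _ Mu, N1l _ Nv).
  have -> : S (F (u + v)) = u.
    rewrite (BopD hF) // (BopD hS); [|exact: BopE|exact: BopE].
    by rewrite SM // SN ?addr0 //; exact: FN1.
  by move=> ->; rewrite add0r.
- apply/seteqP; split=> x; first by move=> Nx; split; [exact: N2l|exact: SN].
  case=> hx Sx; have [_] := P2in _ hx.
  by rewrite -FS // Sx Bop0 // subr0.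
Qed.

(** M1 and M2 are the ranges of the idempotents S F and F S, written as kernels of
their complements so that they are closed; F and S are inverse to each other
between them. *)
Lemma outer_decomposition F S : Bop F -> outer_inverse F S ->
  exists M1 M2, MPhi_decomposition F M1 (ker (fun x => S (F x))) M2 (ker S).
Proof.
move=> hF [hS SFS].
have hSF := Bop_comp hS hF; have hFS := Bop_comp hF hS.
have k1 := Bop_sub hSF Bop_id; have k2 := Bop_sub hFS Bop_id.
exists (ker (fun x => S (F x) - id x)), (ker (fun x => F (S x) - id x)).
have sub0 x y : x - y = 0 -> x = y :> A ^nat by move/eqP; rewrite subr_eq0 => /eqP.
split.
- split; [exact: ker_closed|exact: ker_closed| |].
    apply/seteqP; split=> x; last by move=> ->; split; exact: ker0.
    by move=> [[_ /sub0 h1] [_ h2]]; rewrite -h1 h2.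
  apply/seteqP; split=> x; first by move=> [u [hu _] [v [hv _] <-]]; exact: ell2D.
  move=> hx; exists (S (F x)).
    by split; [ell2_tac|rewrite /= SFS ?subrr //; ell2_tac].
  exists (x - S (F x)); last by rewrite addrC subrK.
  split; first by ell2_tac.
  by rewrite (BopB hSF) ?SFS ?subrr //; ell2_tac.
- split; [exact: ker_closed|exact: ker_closed| |].
    apply/seteqP; split=> x; last by move=> ->; split; exact: ker0.
    by move=> [[_ /sub0 h1] [_ h2]]; rewrite -h1 h2 Bop0.
  apply/seteqP; split=> x; first by move=> [u [hu _] [v [hv _] <-]]; exact: ell2D.
  move=> hx; exists (F (S x)).
    by split; [ell2_tac|rewrite /= SFS ?subrr //; ell2_tac].
  exists (x - F (S x)); last by rewrite addrC subrK.
  split; first by ell2_tac.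
  by rewrite (BopB hS) ?SFS ?subrr //; ell2_tac.
- move=> _ [x [hx /sub0 h] <-]; split; first ell2_tac.
  by rewrite h subrr.
- by move=> _ [x [hx h] <-]; split; first ell2_tac.
- split.
  + split=> [x y [hx _] [hy _]|x a [hx _]]; first exact: BopD.
    exact: Bop_rmul.
  + by have [s s0 Hs] := Bop_bound hF; exists s => x [hx _]; exact: Hs.
  + split.
    * move=> x [hx /sub0 h]; split; first ell2_tac.
      by rewrite h subrr.
    * move=> x y /set_mem [hx /sub0 h1] /set_mem [hy /sub0 h2] e.
      by rewrite -[x]h1 -[y]h2 e.
    * move=> x [hx /sub0 h]; exists (S x) => //; split; first ell2_tac.
      by rewrite SFS ?subrr.
  + exists S => [x [hx /sub0 h]|] //.
    by have [s s0 Hs] := Bop_bound hS; exists s => x [hx _]; exact: Hs.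
Qed.

(** A reformulation of [module_le] by a map that is bounded below, which composes
without any mention of the image. *)
Definition embeds N (N' : set (A ^nat)) := exists h,
  [/\ Alinear_on N h, forall x, N x -> N' (h x), bounded_map_on N h &
      exists s, forall x, N x -> hnorm x <= s * hnorm (h x)].

Lemma lower_gt0 N (h : A ^nat -> A ^nat) :
  (exists s, forall x, N x -> hnorm x <= s * hnorm (h x)) ->
  exists2 s, 0 < s & forall x, N x -> hnorm x <= s * hnorm (h x).
Proof.
case=> s hs; exists (1 + `|s|) => [|x Nx]; first by rewrite ltr_wpDr.
apply: le_trans (hs _ Nx) _; rewrite ler_wpM2r ?hnorm_ge0 //.
by apply: le_trans (ler_norm s) _; rewrite lerDr.
Qed.

Lemma Alinear_sub N h x y : closed_submodule N -> Alinear_on N h -> N x -> N y ->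
  h (x - y) = h x - h y.
Proof.
move=> cN [hD _] Nx Ny; apply/eqP; rewrite -subr_eq opprK -hD ?subrK //.
exact: csub_sub.
Qed.

(** The image of a closed submodule under a map that is bounded below is closed,
since approximations of a point of its closure come from a Cauchy sequence. *)
Lemma module_le_embeds N (N' : set (A ^nat)) : closed_submodule N -> N' `<=` ell2 ->
  module_le N N' <-> embeds N N'.
Proof.
move=> cN N'l; have Nl : N `<=` ell2 by case: cN.
have [_ N0 ND Nr _] := cN.
split=> [[L [f [cL LN' [flin fb [fL _ _] [g gf gb]]]]]|[h [hlin hN' hb /lower_gt0 [s s0 hs]]]].
  exists f; split=> //; first by move=> x Nx; apply/LN'/fL.
  have [s s0 Hs] := bounded_gt0 gb; exists s => x Nx.
  by rewrite -{1}(gf _ Nx); apply: Hs; exact: fL.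
have [hD hr] := hlin.
have lh x : N x -> ell2 (h x) by move=> /hN' /N'l.
have h0 : h 0 = 0 by rewrite -(rmul0 0) hr // !rmul0.
have [t t0 ht] := bounded_gt0 hb.
have cL : closed_submodule (h @` N).
  split.
  - by move=> _ [x Nx <-]; exact: lh.
  - by exists 0.
  - by move=> _ _ [x Nx <-] [y Ny <-]; exists (x + y); [exact: ND|rewrite hD].
  - by move=> _ a [x Nx <-]; exists (rmul x a); [exact: Nr|rewrite hr].
  move=> x lx H.
  have q0 n : 0 < 2^-1 ^+ n :> R by rewrite exprn_gt0 // invr_gt0.
  have /choice[z Hz] n : exists z, N z /\ hnorm (x - h z) <= 2^-1 ^+ n.
    by have [_ [z Nz <-] hz] := H _ (q0 n); exists z; split=> //; exact: ltW.
  have Nz n : N (z n) by have [] := Hz n.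
  have half1 : 2^-1 < 1 :> R by rewrite invf_lt1 // ltr1n.
  have small k e : 0 < e -> exists n, k * 2^-1 ^+ n <= e.
    by move=> e0; apply: geom_small => //; rewrite invr_ge0.
  have [||||y ly uy] := @ell2_cvg_majorant _ _ z (fun n => 4 * s * 2^-1 ^+ n).
  - by move=> n; exact: Nl.
  - by move=> n; rewrite !mulr_ge0 // ltW.
  - move=> n; apply: le_trans (hs _ (csub_sub cN (Nz _) (Nz _))) _.
    rewrite (Alinear_sub cN hlin) //.
    have [_ h1] := Hz n; have [_ h2] := Hz n.+1.
    apply: (@le_trans _ _ (s * (2^-1 ^+ n.+1 + 2^-1 ^+ n))).
      rewrite ler_pM2l //; apply: le_trans (hnorm_dist (lh _ (Nz _)) lx (lh _ (Nz _))) _.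
      by rewrite lerD // hnormBC.
    rewrite exprS; have := q0 n; set w := 2^-1 ^+ n => w0.
    have : 0 < s * w by rewrite mulr_gt0.
    lra.
  - exact: small.
  have Ny : N y by exact: (csub_lim cN Nz ly uy (small _)).
  exists y => //; apply/eqP; rewrite -subr_eq0; apply/eqP.
  apply: (@hnorm_small_eq0 _ 2); first by apply: ell2B => //; exact: lh.
  move=> d d0; have [n Hn] := small (t * (4 * s) + 1) _ d0.
  apply: le_trans (hnorm_dist (lh _ Ny) (lh _ (Nz n)) lx) _.
  rewrite -(Alinear_sub cN hlin) //.
  have h1 := ht _ (csub_sub cN Ny (Nz n)).
  have h2 : t * hnorm (y - z n) <= t * (4 * s * 2^-1 ^+ n).
    by rewrite ler_pM2l // hnormBC.
  have [_ h3] := Hz n; rewrite hnormBC in h3.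
  have := q0 n; move: Hn h1 h2 h3; set w := 2^-1 ^+ n.
  move=> Hn h1 h2 h3 w0.
  have h4 : (t * (4 * s) + 1) * w = t * (4 * s * w) + w by ring.
  rewrite h4 in Hn; lra.
have /choice[g Hg] y : exists x, (h @` N) y -> N x /\ h x = y.
  have [[x Nx <-]|ny] := pselect ((h @` N) y); last by exists 0.
  by exists x.
have inj x y : N x -> N y -> h x = h y -> x = y.
  move=> Nx Ny e; apply/eqP; rewrite -subr_eq0; apply/eqP.
  have Nxy := csub_sub cN Nx Ny.
  apply: hnorm_eq0; first exact: Nl.
  by apply: le_trans (hs _ Nxy) _; rewrite (Alinear_sub cN hlin) // e subrr hnorm0 mulr0.
exists (h @` N), h; split=> //; first by move=> _ [x Nx <-]; exact: hN'.
split=> //.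
  split.
  - by move=> x Nx; exists x.
  - by move=> x y /set_mem Nx /set_mem Ny; exact: inj.
  - by move=> _ [x Nx <-]; exists x.
exists g.
  move=> x Nx; have [|N1 e] := Hg (h x); first by exists x.
  exact: inj.
exists s => y Ly; have [N1 e] := Hg _ Ly.
by rewrite -{2}e; exact: hs.
Qed.

Lemma fin_gen_image N V : Bop V -> N `<=` ell2 -> fin_gen N -> fin_gen (V @` N).
Proof.
move=> hV Nl [n [g NE]]; exists n, (fun i => V (g i)).
have lg i : ell2 (g i) by apply: Nl; rewrite NE; exact: fin_gen_mem.
have VE (a : 'I_n -> A) : V (\sum_(i < n) rmul (g i) (a i)) = \sum_(i < n) rmul (V (g i)) (a i).
  suff : ell2 (\sum_(i < n) rmul (g i) (a i)) /\
    V (\sum_(i < n) rmul (g i) (a i)) = \sum_(i < n) rmul (V (g i)) (a i) by case.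
  elim/big_rec2: _ => [|i u v _ [lv <-]]; first by rewrite (Bop0 hV); split=> //; exact: ell2_0.
  have lr := ell2_rmul (a := a i) (lg i).
  by split; [exact: ell2D|rewrite (BopD hV) // (Bop_rmul _ hV)].
apply/seteqP; split=> x.
  by move=> [y]; rewrite {1}NE => -[a _ <-] <-; exists a => //; rewrite VE.
by move=> [a _ <-]; exists (\sum_(i < n) rmul (g i) (a i)); [rewrite NE; exists a|rewrite VE].
Qed.

Lemma fin_gen_ker_tail m : fin_gen (ker (tail m)).
Proof.
pose dl (i : 'I_m) : A ^nat := fun k => if k == i then 1 else 0.
have ldl i : ell2 (dl i).
  apply/ell2P => e e0; exists m => n.
  have -> : tail m (dl i) = 0.
    apply/funext => k; rewrite /tail /dl; case: ltnP => // mk.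
    by rewrite gtn_eqF // (leq_trans (ltn_ord i)).
  by rewrite /pnorm /pinner big1 ?rnorm0 ?sqrtr0 ?ltW // => k _; rewrite mulr0.
have sumE (a : 'I_m -> A) k : (\sum_(i < m) rmul (dl i) (a i)) k =
    \sum_(i < m) (if k == i then a i else 0).
  rewrite fct_sumE; apply: eq_bigr => i _; rewrite /rmul /dl.
  by case: ifP; rewrite ?mul1r ?mul0r.
exists m, dl; apply/seteqP; split=> x.
  move=> [lx tx]; exists (fun i => x i) => //; apply/funext => k; rewrite sumE.
  have [km|mk] := ltnP k m.
    rewrite (bigD1 (Ordinal km)) //= eqxx big1 ?addr0 // => i.
    by rewrite -val_eqE /= eq_sym => /negbTE ->.
  rewrite big1 => [|i _]; last by rewrite gtn_eqF // (leq_trans (ltn_ord i)).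
  by have := congr1 (fun f => f k) tx; rewrite /tail ltnNge mk.
move=> [a _ <-]; split.
  by apply: ell2_sum => i _; exact: ell2_rmul.
apply/funext => k; rewrite /tail; case: ltnP => // mk.
rewrite sumE big1 // => i _; by rewrite gtn_eqF // (leq_trans (ltn_ord i)).
Qed.

End Decomposition.

(** * Perturbation *)

Section Perturbation.
Context {R : realType} {A : cstarAlgType R}.
Implicit Types (a b c : A) (s t e q : R) (x y z : A ^nat) (m n : nat).
Implicit Types (M N : set (A ^nat)) (T S F D K V E : A ^nat -> A ^nat).

Definition inverts_1D T V :=
  [/\ Bop V, forall x, ell2 x -> V x + T (V x) = x &
      forall x, ell2 x -> V (x + T x) = x].

Lemma inverse_half T : Bop T -> (forall x, ell2 x -> hnorm (T x) <= 2^-1 * hnorm x) ->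
  exists2 V, inverts_1D T V & forall x, ell2 x -> hnorm (V x) <= 2 * hnorm x.
Proof.
move=> hT Th; have h1 : 2^-1 < 1 :> R by rewrite invf_lt1 // ltr1n.
have h0 : 0 <= 2^-1 :> R by rewrite invr_ge0.
have [V [hV V1 V2 Vb]] := neumann hT h0 h1 Th.
exists V => // x hx; apply: le_trans (Vb _ hx) _.
by rewrite (_ : (1 - 2^-1)^-1 = 2 :> R) //; field.
Qed.

(** The inverse of 1 + S D is 1 - S V D when V is that of 1 + D S. *)
Lemma inverse_swap S D V : Bop S -> Bop D ->
  inverts_1D (fun x => D (S x)) V ->
  exists W, inverts_1D (fun x => S (D x)) W.
Proof.
move=> hS hD [hV V1 V2].
have hSVD := Bop_comp hS (Bop_comp hV hD).
exists (fun x => x - S (V (D x))); split; first exact: Bop_sub Bop_id hSVD.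
- move=> x hx; have hDx := BopE hD hx.
  rewrite (BopB hD) ?(BopB hS); try by ell2_tac.
  have := V1 _ hDx => e; have := congr1 S e.
  rewrite (BopD hS); try by ell2_tac.
  by move=> <-; rewrite addrK subrK.
- move=> x hx.
  rewrite (BopD hD); try by ell2_tac.
  rewrite V2; last by ell2_tac.
  by rewrite addrK.
Qed.

Section Perturb.
Variables (F S D V : A ^nat -> A ^nat).
Hypotheses (hF : Bop F) (hFS : outer_inverse F S) (hD : Bop D)
  (hV : inverts_1D (fun x => S (D x)) V).

(** Put w = V S x, so that w + S D w = S x.  Then w = S (x - D w) lies in the range
of S, where S F is the identity, and S (F + D) w = w + S D w = S x. *)
Lemma perturb_outer : outer_inverse (F \+ D) (fun x => V (S x)).
Proof.
have [hS SFS] := hFS; have [bV V1 V2] := hV.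
split=> [|x hx]; first exact: Bop_comp.
congr V; set w := V (S x).
have hw : ell2 w by rewrite /w; ell2_tac.
have wE : w + S (D w) = S x by apply: V1; ell2_tac.
have wS : w = S (x - D w) by rewrite (BopB hS) -?wE ?addrK //; ell2_tac.
have SFw : S (F w) = w by rewrite wS SFS //; ell2_tac.
by rewrite /= (BopD hS) ?SFw //; ell2_tac.
Qed.

Lemma perturb_ker : ker (fun x => V (S x)) = ker S.
Proof.
have [hS SFS] := hFS; have [bV V1 V2] := hV.
apply/seteqP; split=> x [hx e]; split=> //; last by rewrite e Bop0.
have := V1 _ (BopE hS hx); rewrite e (Bop0 hD) (Bop0 hS) addr0 //.
Qed.

(** V and 1 + S D are inverse bijections between the two kernels: for
y = x + S D x one has S F y = S (F + D) x, because S F S = S. *)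
Lemma perturb_ker_domain :
  ker (fun x => V (S ((F \+ D) x))) = V @` ker (fun x => S (F x)).
Proof.
have [hS SFS] := hFS; have [bV V1 V2] := hV.
apply/seteqP; split=> x.
  move=> [hx e].
  have e1 : S (F x) + S (D x) = 0.
    have hx' : ell2 (S (F x + D x)) by ell2_tac.
    rewrite -(BopD hS); try by ell2_tac.
    by have := V1 _ hx'; rewrite [V _]e (Bop0 hD) (Bop0 hS) addr0 => <-.
  exists (x + S (D x)); last exact: V2.
  split; first by ell2_tac.
  by rewrite (BopD hF) ?(BopD hS) ?SFS //; ell2_tac.
move=> [y [hy SFy] <-]; have hVy := BopE bV hy.
split=> //; rewrite /= -[RHS](Bop0 bV); congr V.
rewrite (BopD hS); try by ell2_tac.
rewrite -(SFS (D _)) -?(BopD hS) -?(BopD hF) ?V1 //; ell2_tac.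
Qed.

End Perturb.

Lemma embeds_comp_left N (N' N'' : set (A ^nat)) U V : Bop U -> Bop V -> N' `<=` ell2 ->
  (forall x, N' x -> N (U x)) -> (forall x, N' x -> V (U x) = x) ->
  N `<=` ell2 -> embeds N N'' -> embeds N' N''.
Proof.
move=> hU hV N'l UN VU Nl [h [[hD hr] hN hb /lower_gt0[s s0 hs]]].
have [t t0 Ht] := bounded_gt0 hb; have [u u0 Hu] := Bop_bound hU.
have [v v0 Hv] := Bop_bound hV.
exists (fun x => h (U x)); split.
- split=> [x y Nx Ny|x a Nx].
    by rewrite (BopD hU) ?hD //; [exact: UN|exact: UN|exact: N'l|exact: N'l].
  by rewrite (Bop_rmul _ hU) ?hr //; [exact: UN|exact: N'l].
- by move=> x Nx; apply/hN/UN.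
- exists (t * u) => x Nx; apply: le_trans (Ht _ (UN _ Nx)) _.
  by rewrite -mulrA ler_pM2l //; apply/Hu/N'l.
- exists (v * s) => x Nx; rewrite -{1}(VU _ Nx).
  apply: le_trans (Hv _ (Nl _ (UN _ Nx))) _.
  by rewrite -mulrA ler_pM2l //; apply/hs/UN.
Qed.

Lemma embeds_comp_right N (N' N'' : set (A ^nat)) U V : Bop U -> Bop V -> N' `<=` ell2 ->
  (forall x, N' x -> N'' (V x)) -> (forall x, N' x -> U (V x) = x) ->
  embeds N N' -> embeds N N''.
Proof.
move=> hU hV N'l VN UV [h [[hD hr] hN hb [s hs]]].
have [t t0 Ht] := bounded_gt0 hb; have [u u0 Hu] := Bop_bound hU.
have [v v0 Hv] := Bop_bound hV.
have lh x : N x -> ell2 (h x) by move=> /hN /N'l.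
exists (fun x => V (h x)); split.
- split=> [x y Nx Ny|x a Nx].
    by rewrite hD // (BopD hV) //; exact: lh.
  by rewrite hr // (Bop_rmul _ hV) //; exact: lh.
- by move=> x Nx; apply/VN/hN.
- exists (v * t) => x Nx; apply: le_trans (Hv _ (lh _ Nx)) _.
  by rewrite -mulrA ler_pM2l //; exact: Ht.
- exists (`|s| * u) => x Nx; apply: le_trans (hs _ Nx) _.
  apply: (@le_trans _ _ (`|s| * hnorm (h x))).
    by rewrite ler_wpM2r ?hnorm_ge0 // ler_norm.
  rewrite -mulrA ler_wpM2l // -{1}(UV _ (hN _ Nx)).
  by apply: Hu; apply: BopE => //; exact: lh.
Qed.

(** The defining conditions of the two classes in terms of an outer inverse. *)
Definition plus_data F S := [/\ outer_inverse F S,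
  fin_gen (ker (fun x => S (F x))) & embeds (ker (fun x => S (F x))) (ker S)].

Definition minus_data F S := [/\ outer_inverse F S,
  fin_gen (ker S) & embeds (ker S) (ker (fun x => S (F x)))].

Lemma ker_ell2 T : ker T `<=` ell2. Proof. by move=> x []. Qed.

Lemma MPhi_plusP F : MPhi_plus_minus' A F <-> Ba F /\ exists S, plus_data F S.
Proof.
split=> [[bF [M1 [N1 [M2 [N2 [dec fg le]]]]]]|[bF [S [[hS SFS] fg em]]]].
  split=> //; have [S [hS e1 e2]] := decomposition_outer (Ba_Bop bF) dec.
  exists S; split; rewrite -?e1 -?e2 //; apply/module_le_embeds => //.
    by case: dec => -[].
  by rewrite e2; exact: ker_ell2.
split=> //; have hF := Ba_Bop bF.
have [M1 [M2 dec]] := outer_decomposition hF (conj hS SFS).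
exists M1, (ker (fun x => S (F x))), M2, (ker S); split=> //.
by apply/module_le_embeds => //; [exact/ker_closed/Bop_comp|exact: ker_ell2].
Qed.

Lemma MPhi_minusP F : MPhi_minus_plus' A F <-> Ba F /\ exists S, minus_data F S.
Proof.
split=> [[bF [M1 [N1 [M2 [N2 [dec fg le]]]]]]|[bF [S [[hS SFS] fg em]]]].
  split=> //; have [S [hS e1 e2]] := decomposition_outer (Ba_Bop bF) dec.
  exists S; split; rewrite -?e1 -?e2 //; apply/module_le_embeds => //.
    by case: dec => _ [].
  by rewrite e1; exact: ker_ell2.
split=> //; have hF := Ba_Bop bF.
have [M1 [M2 dec]] := outer_decomposition hF (conj hS SFS).
exists M1, (ker (fun x => S (F x))), M2, (ker S); split=> //.
by apply/module_le_embeds => //; [exact/ker_closed|exact: ker_ell2].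
Qed.

Lemma plus_perturb F S D V : Bop F -> plus_data F S -> Bop D ->
  inverts_1D (fun x => S (D x)) V -> exists S', plus_data (F \+ D) S'.
Proof.
move=> hF [hFS fg em] hD hV; have [hS SFS] := hFS; have [bV V1 V2] := hV.
have hU : Bop (fun x => x + S (D x)) := Bop_add Bop_id (Bop_comp hS hD).
have kl := @ker_ell2 (fun x => S (F x)).
exists (fun x => V (S x)); split; first exact: perturb_outer.
  by rewrite (perturb_ker_domain hF hFS hD hV); exact: fin_gen_image.
rewrite (perturb_ker_domain hF hFS hD hV) (perturb_ker hFS hD hV).
have UV x : ell2 x -> V x + S (D (V x)) = x by exact: V1.
apply: (embeds_comp_left hU bV _ _ _ kl em).
- by move=> _ [x /kl hx <-]; exact: BopE.
- by move=> _ [x kx <-]; rewrite UV //; exact: kl.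
- by move=> _ [x /kl hx <-]; apply: V2; exact: BopE.
Qed.

Lemma minus_perturb F S D V : Bop F -> minus_data F S -> Bop D ->
  inverts_1D (fun x => S (D x)) V -> exists S', minus_data (F \+ D) S'.
Proof.
move=> hF [hFS fg em] hD hV; have [hS SFS] := hFS; have [bV V1 V2] := hV.
have hU : Bop (fun x => x + S (D x)) := Bop_add Bop_id (Bop_comp hS hD).
have kl := @ker_ell2 (fun x => S (F x)).
exists (fun x => V (S x)); split; first exact: perturb_outer.
  by rewrite (perturb_ker hFS hD hV).
rewrite (perturb_ker_domain hF hFS hD hV) (perturb_ker hFS hD hV).
apply: (embeds_comp_right hU bV kl _ _ em).
- by move=> x kx; exists x.
- by move=> x /kl hx; exact: V1.
Qed.

Lemma opnorm_bound D x : Bop D -> ell2 x -> hnorm (D x) <= opnorm D * hnorm x.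
Proof.
move=> hD hx; have [s s0 Hs] := Bop_bound hD.
have unit y : ell2 y -> hnorm y <= 1 -> hnorm (D y) <= opnorm D.
  move=> hy y1; apply: ub_le_sup; last by exists y.
  exists s => _ [z [hz z1] <-]; apply: le_trans (Hs _ hz) _.
  by rewrite ler_piMr // ltW.
have [x0|x0] := eqVneq (hnorm x) 0.
  have -> : x = 0 by apply: hnorm_eq0; rewrite ?x0.
  by rewrite (Bop0 hD) hnorm0 mulr0.
have xp : 0 < hnorm x by rewrite lt_def x0 hnorm_ge0.
pose y := hscale (hnorm x)^-1 x.
have hy : ell2 y by exact: ell2_rmul.
have y1 : hnorm y <= 1.
  by apply: le_trans (hnorm_scale _ hx) _; rewrite gtr0_norm ?invr_gt0 // mulVf.
have -> : D x = hscale (hnorm x) (D y).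
  by rewrite /y /hscale (Bop_rmul _ hD) // -[LHS](hscaleK _ x0).
apply: le_trans (hnorm_scale _ (BopE hD hy)) _.
rewrite gtr0_norm // mulrC ler_pM2r //; exact: unit.
Qed.

Lemma inner_star x y : ell2 x -> ell2 y -> star (inner x y) = inner y x.
Proof.
move=> hx hy; apply: tends_unique (inner_tends hy hx) => e e0.
have [N HN] := inner_tends hx hy e0; exists N => n /HN.
by rewrite -rnorm_star starB pinner_star.
Qed.

Lemma Ba_add F K : Ba F -> Ba K -> Ba (F \+ K).
Proof.
move=> bF bK; have hFK := Bop_add (Ba_Bop bF) (Ba_Bop bK).
have [hF hK] := (Ba_Bop bF, Ba_Bop bK).
case: hFK bF bK => h1 h2 h3 [_ _ _ [G1 G1l G1E]] [_ _ _ [G2 G2l G2E]].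
split=> //; exists (fun x => G1 x + G2 x).
  by move=> x hx; apply: ell2D; [exact: G1l|exact: G2l].
move=> x y hx hy; rewrite innerDr //; [|exact: G1l|exact: G2l].
rewrite -G1E // -G2E //.
by rewrite /= -inner_star ?innerDr ?starD ?inner_star //; ell2_tac.
Qed.

(** The property of compact operators that the perturbation argument uses. *)
Definition tail_small K := Bop K /\ forall e, 0 < e -> exists m0, forall m, (m0 <= m)%N ->
  forall z, ell2 z -> hnorm (K (tail m z)) <= e * hnorm z /\
                      hnorm (tail m (K z)) <= e * hnorm z.

Lemma tail_small0 : tail_small (fun=> 0).
Proof.
split.
  split; first by move=> x _; exact: ell2_0.
    by split=> [x y _ _|x a _]; rewrite ?addr0 ?rmul0l.
  by exists 0 => x _; rewrite hnorm0 mul0r.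
move=> e e0; exists 0%N => m _ z hz.
by rewrite (Bop0 (Bop_tail m)) hnorm0 mulr_ge0 ?hnorm_ge0 // ltW.
Qed.

Lemma tail_smallD K T : tail_small K -> tail_small T -> tail_small (fun x => K x + T x).
Proof.
move=> [hK Ks] [hT Ts]; split; first exact: Bop_add.
move=> e e0; have e2 : 0 < e / 2 by rewrite divr_gt0.
have [m1 H1] := Ks _ e2; have [m2 H2] := Ts _ e2.
exists (maxn m1 m2) => m; rewrite geq_max => /andP[/H1 {}H1 /H2 {}H2] z hz.
have [h1 h2] := H1 _ hz; have [h3 h4] := H2 _ hz.
rewrite [e]splitr mulrDl tailD; split.
  by apply: le_trans (hnormD _ _) (lerD h1 h3); ell2_tac.
by apply: le_trans (hnormD _ _) (lerD h2 h4); ell2_tac.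
Qed.

(** On [tail m z] the operator pairs z with the tail of y, and the tail of a value is
a multiple of the tail of x; both tails tend to 0. *)
Lemma tail_small_rank_one x y : ell2 x -> ell2 y -> tail_small (rank_one x y).
Proof.
move=> hx hy.
have bd z : ell2 z -> hnorm (rank_one x y z) <= hnorm x * hnorm y * hnorm z.
  move=> hz; apply: le_trans (hnorm_rmul _ hx) _.
  by rewrite -mulrA ler_wpM2l ?hnorm_ge0 ?inner_CS.
split.
  split; first by move=> z hz; exact: ell2_rmul.
    split=> [u v hu hv|u a hu]; rewrite /rank_one.
      by rewrite innerDr // rmulDr.
    by rewrite inner_rmul // rmulA.
  by exists (hnorm x * hnorm y).
move=> e e0; pose d := e / (1 + (hnorm x + hnorm y)).
have dp : 0 < 1 + (hnorm x + hnorm y) by rewrite ltr_wpDr ?addr_ge0 ?hnorm_ge0.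
have d0 : 0 < d by rewrite divr_gt0.
have [m1 H1] := tail_to0 hx d0; have [m2 H2] := tail_to0 hy d0.
have de t : 0 <= t -> t <= hnorm x + hnorm y -> d * t <= e.
  move=> t0 tl; rewrite /d mulrAC ler_pdivrMr // ler_pM2l //.
  by apply: le_trans tl _; rewrite lerDr.
exists (maxn m1 m2) => m; rewrite geq_max => /andP[/H1 {}H1 /H2 {}H2] z hz; split.
  rewrite /rank_one inner_tail; apply: le_trans (hnorm_rmul _ hx) _.
  apply: (@le_trans _ _ (hnorm x * (d * hnorm z))).
    rewrite ler_wpM2l ?hnorm_ge0 //.
    apply: le_trans (inner_CS (ell2_tail hy) hz) _.
    by rewrite ler_wpM2r ?hnorm_ge0.
  rewrite mulrA ler_wpM2r ?hnorm_ge0 // mulrC de ?hnorm_ge0 // lerDl hnorm_ge0 //.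
rewrite /rank_one tail_rmul; apply: le_trans (hnorm_rmul _ (ell2_tail hx)) _.
apply: (@le_trans _ _ (d * (hnorm y * hnorm z))).
  by apply: ler_pM; rewrite ?hnorm_ge0 ?rnorm_ge0 ?inner_CS.
by rewrite mulrA ler_wpM2r ?hnorm_ge0 // de ?hnorm_ge0 // lerDr hnorm_ge0.
Qed.

Lemma tail_small_rank_one_span T : rank_one_span T -> tail_small T.
Proof.
move=> [n [c [x [y [hxy ->]]]]].
elim: (index_enum _) => [|i r IH].
  suff -> : (fun z => \sum_(i <- [::]) c i *: rank_one (x i) (y i) z) = (fun=> 0 : A ^nat).
    exact: tail_small0.
  by apply/funext => z; rewrite big_nil.
suff -> : (fun z => \sum_(j <- i :: r) c j *: rank_one (x j) (y j) z) =
  (fun z => rank_one (rmul (x i) (c i *: (1 : A))) (y i) z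
            + \sum_(j <- r) c j *: rank_one (x j) (y j) z).
  apply: tail_smallD => //; have [hx hy] := hxy i.
  by apply: tail_small_rank_one => //; exact: ell2_rmul.
apply/funext => z; rewrite big_cons; congr (_ + _).
by apply/funext => k; rewrite /rank_one /rmul !fctE scale_mulr mulr1 scale_mull.
Qed.

Lemma tail_small_compact K : compact_op A K -> tail_small K.
Proof.
move=> [bK HK]; have hK := Ba_Bop bK; split=> // e e0.
have e2 : 0 < e / 2 by rewrite divr_gt0.
have [T /tail_small_rank_one_span [hT Ts] KT] := HK _ e2.
have [m0 Hm] := Ts _ e2.
have hKT : Bop (K \- T) by exact: Bop_sub.
have bd z : ell2 z -> hnorm ((K \- T) z) <= e / 2 * hnorm z.
  move=> hz; apply: le_trans (opnorm_bound hKT hz) _.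
  by rewrite ler_wpM2r ?hnorm_ge0 // ltW.
have KE z : K z = (K \- T) z + T z by rewrite /= subrK.
have e2' : 0 <= e / 2 by exact: ltW.
exists m0 => m /Hm {}Hm z hz; have [h1 h2] := Hm _ hz.
have ht := ell2_tail (m := m) hz.
rewrite [e]splitr mulrDl !KE; split.
  apply: le_trans (hnormD (BopE hKT ht) (BopE hT ht)) _.
  apply: lerD => //; apply: le_trans (bd _ ht) _.
  by rewrite ler_wpM2l // hnorm_tail.
rewrite tailD.
apply: le_trans (hnormD (ell2_tail (BopE hKT hz)) (ell2_tail (BopE hT hz))) _.
apply: lerD => //; apply: le_trans (bd _ hz).
exact: hnorm_tail (BopE hKT hz).
Qed.

(** With Q = [tail m] and m large, W = 1 - Q P is close to 1.  On N it is 1 - Q, so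
Q W P = 0 and E = W^-1 Q W kills N, while ker E = W^-1 (ker Q).  Writing
E x = Q u with u = W x + P E x shows that K E is as small as K Q; and
Q W K = Q K - Q P K shows that E K is as small as Q K and Q P. *)
Lemma cofinite_projection K N P d : tail_small K -> Bop P -> closed_submodule N -> fin_gen N ->
  (forall x, ell2 x -> N (P x)) -> (forall x, N x -> P x = x) -> 0 < d ->
  exists E, [/\ Bop E, forall x, ell2 x -> E (E x) = E x,
    forall x, ell2 x -> E (P x) = 0, fin_gen (ker E) &
    forall x, ell2 x -> hnorm (K (E x)) <= d * hnorm x /\ hnorm (E (K x)) <= d * hnorm x].
Proof.
move=> [hK Ks] hP cN fgN PN NP d0.
have [p p0 Hp] := Bop_bound hP; have [k k0 Hk] := Bop_bound hK.
have pk : 0 < p * k by rewrite mulr_gt0.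
pose B := 2 * (1 + 2 * p) + 2 * (1 + p * k).
have B0 : 0 < B by rewrite /B; lra.
(* e p <= 1/2 makes W invertible; e B <= d covers both products with K *)
pose e := Num.min (2^-1 / p) (d / B).
have e0 : 0 < e by rewrite lt_min !divr_gt0 // invr_gt0.
have [ep ed] : e * p <= 2^-1 /\ e * B <= d.
  by rewrite -!ler_pdivlMr // /e !ge_min !lexx orbT.
have [m1 Hm1] := Ks _ e0; have [m2 Hm2] := fin_gen_tail cN fgN e0.
pose m := maxn m1 m2.
have {}Hm1 := Hm1 m (leq_maxl _ _); have {}Hm2 := Hm2 m (leq_maxr _ _).
have hQ : Bop (tail m) := Bop_tail m.
have QPb x : ell2 x -> hnorm (tail m (P x)) <= e * (p * hnorm x).
  move=> hx; apply: le_trans (Hm2 _ (PN _ hx)) _.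
  by rewrite ler_pM2l //; exact: Hp.
pose T x := - tail m (P x).
have hT : Bop T by exact/Bop_opp/Bop_comp.
have Tb x : ell2 x -> hnorm (T x) <= 2^-1 * hnorm x.
  move=> hx; rewrite hnormN; apply: le_trans (QPb _ hx) _.
  by rewrite mulrA ler_wpM2r ?hnorm_ge0.
have [V [hV V1 V2] Vb] := inverse_half hT Tb.
pose W x := x + T x.
have hW : Bop W by exact: Bop_add Bop_id hT.
have Wb x : ell2 x -> hnorm (W x) <= 2 * hnorm x.
  move=> hx; apply: le_trans (hnormD hx (BopE hT hx)) _.
  by have := Tb _ hx; have := hnorm_ge0 x; lra.
have QWP x : ell2 x -> tail m (W (P x)) = 0.
  move=> hx; rewrite /W /T tailD tailN (NP (P x)) ?tailK ?subrr //; exact: PN.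
pose E x := V (tail m (W x)).
have hE : Bop E by exact/Bop_comp/Bop_comp.
exists E; split=> //.
- by move=> x hx; rewrite /E /W V1 ?tailK //; ell2_tac.
- by move=> x hx; rewrite /E QWP // Bop0.
- suff -> : ker E = V @` ker (tail m).
    by apply: fin_gen_image => //; [exact: ker_ell2|exact: fin_gen_ker_tail].
  apply/seteqP; split=> x.
    move=> [hx Ex]; exists (W x); last exact: V2.
    split; first by ell2_tac.
    have := V1 (tail m (W x)); rewrite -/(E x) Ex (Bop0 hT) addr0 => <- //.
    by ell2_tac.
  move=> [y [hy Qy] <-]; split; first by ell2_tac.
  by rewrite /E /W V1 // Qy Bop0.
- move=> x hx.
  have hWx : ell2 (W x) by ell2_tac.
  split.
    have EE : E x = tail m (W x + P (E x)).
      have := V1 (tail m (W x)) (ell2_tail hWx); rewrite -/(E x) /T => /eqP.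
      by rewrite subr_eq -tailD => /eqP.
    have hE1 : ell2 (E x) by ell2_tac.
    have hu : ell2 (W x + P (E x)) by ell2_tac.
    rewrite EE; have [h1 _] := Hm1 _ hu; apply: le_trans h1 _.
    have Eb : hnorm (E x) <= 2 * hnorm (W x).
      apply: le_trans (Vb _ (ell2_tail hWx)) _.
      by rewrite ler_pM2l // hnorm_tail.
    have ub : hnorm (W x + P (E x)) <= (2 * (1 + 2 * p)) * hnorm x.
      apply: le_trans (hnormD hWx (BopE hP hE1)) _.
      have := Hp _ hE1; have := Wb _ hx; have := hnorm_ge0 x.
      move=> g1 g2 g3.
      have : p * hnorm (E x) <= p * (2 * (2 * hnorm x)).
        rewrite ler_pM2l //; apply: le_trans Eb _; by rewrite ler_pM2l.
      lra.
    apply: (@le_trans _ _ (e * (B * hnorm x))); last first.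
      by rewrite mulrA ler_wpM2r ?hnorm_ge0.
    rewrite ler_pM2l //; apply: le_trans ub _; rewrite ler_wpM2r ?hnorm_ge0 //.
    by rewrite /B lerDl; lra.
  have hKx := BopE hK hx.
  apply: le_trans (Vb _ _) _; first by ell2_tac.
  rewrite /W tailD tailN tailK.
  have [_ h1] := Hm1 _ hx; have h2 := QPb _ hKx; have h3 := Hk _ hx.
  have hb : hnorm (tail m (K x) - tail m (P (K x))) <=
      hnorm (tail m (K x)) + hnorm (tail m (P (K x))).
    by apply: hnormB; ell2_tac.
  apply: (@le_trans _ _ (e * (B * hnorm x))); last first.
    by rewrite mulrA ler_wpM2r ?hnorm_ge0.
  have h4 : e * (p * hnorm (K x)) <= e * (p * (k * hnorm x)) by rewrite !ler_pM2l.
  have h5 : e * (2 * (1 + p * k) * hnorm x) <= e * (B * hnorm x).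
    by rewrite ler_pM2l // ler_wpM2r ?hnorm_ge0 // /B lerDr; lra.
  have h6 : e * (2 * (1 + p * k) * hnorm x) =
    2 * (e * hnorm x + e * (p * (k * hnorm x))) by ring.
  lra.
Qed.

(** E S is an outer inverse of F because E S F = E (1 - P) = E.  The map
h x = f (P x) + F (x - P x) sends ker E to ker (E S), and it is bounded below
since S (h x) = x - P x returns the second part of x, after which f (P x) is
known. *)
Lemma plus_compact F K : Bop F -> tail_small K -> (exists S, plus_data F S) ->
  exists S, plus_data (F \+ K) S.
Proof.
move=> hF hKt [S [[hS SFS] fgN [f [flin fN fb /lower_gt0[c c0 fl]]]]].
have [hK _] := hKt.
pose N := ker (fun x => S (F x)).
have hSF := Bop_comp hS hF.
pose P x := x - S (F x).
have hP : Bop P by exact: Bop_sub Bop_id hSF.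
have PN x : ell2 x -> N (P x).
  move=> hx; split; first by ell2_tac.
  by rewrite /P (BopB hSF) ?SFS ?subrr //; ell2_tac.
have NP x : N x -> P x = x by move=> [hx e]; rewrite /P e subr0.
have [s s0 Hs] := Bop_bound hS.
have d0 : 0 < 2^-1 / s by rewrite divr_gt0 // invr_gt0.
have [E [hE EE EP fgE Eb]] := cofinite_projection hKt hP (ker_closed hSF) fgN PN NP d0.
have ESF x : ell2 x -> E (S (F x)) = E x.
  move=> hx; have -> : S (F x) = x - P x by rewrite /P subKr.
  by rewrite (BopB hE) ?EP ?subr0 //; ell2_tac.
have hS2 : Bop (fun x => E (S x)) by exact: Bop_comp.
have [lD lr] := flin.
have fl2 x : ell2 x -> ell2 (f (P x)) by move=> /PN /fN [].
have Sf x : ell2 x -> S (f (P x)) = 0 by move=> /PN /fN [].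
have kE : ker (fun x => E (S (F x))) = ker E.
  by apply/seteqP; split=> x [hx]; rewrite ?ESF // => e; split=> //=; rewrite ESF.
have data : plus_data F (fun x => E (S x)).
  split; first by split=> // x hx; rewrite ESF ?EE //; ell2_tac.
    by rewrite kE.
  rewrite kE; exists (fun x => f (P x) + F (x - P x)).
  have hFP : Bop (fun x => F (x - P x)) by exact: Bop_comp hF (Bop_sub Bop_id hP).
  have [t t0 Ht] := bounded_gt0 fb; have [u u0 Hu] := Bop_bound hFP.
  have [p p0 Hp] := Bop_bound hP; have [v v0 Hv] := Bop_bound hF.
  split.
  - split=> [x y [hx _] [hy _]|x a [hx _]].
      rewrite (BopD hP) // lD; [|exact: PN|exact: PN].
      by rewrite -(BopD hP) // (BopD hFP) // addrACA.
    rewrite (Bop_rmul _ hP) // lr; last exact: PN.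
    by rewrite -(Bop_rmul _ hP) // (Bop_rmul _ hFP) // rmulDl.
  - move=> x [hx Ex]; split; first by apply: ell2D; [exact: fl2|exact: (BopE hFP)].
    rewrite (BopD hS) ?Sf ?add0r //; [|exact: fl2|exact: (BopE hFP)].
    rewrite ESF; last by ell2_tac.
    by rewrite (BopB hE) ?Ex ?EP ?subr0 //; ell2_tac.
  - exists (t * p + u) => x [hx _].
    apply: le_trans (hnormD (fl2 _ hx) (BopE hFP hx)) _.
    rewrite mulrDl; apply: lerD; last exact: Hu.
    apply: le_trans (Ht _ (PN _ hx)) _; rewrite -mulrA ler_pM2l //; exact: Hp.
  - exists (c * (1 + v * s) + s) => x [hx _].
    set h := f (P x) + F (x - P x).
    have hh : ell2 h by apply: ell2D; [exact: fl2|exact: (BopE hFP)].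
    have Sh : S h = x - P x.
      rewrite (BopD hS) ?Sf ?add0r //; [|exact: fl2|exact: (BopE hFP)].
      by rewrite /P subKr SFS //; ell2_tac.
    have fh : f (P x) = h - F (S h) by rewrite Sh /h addrK.
    (* S h returns x - P x, and h - F (S h) then returns f (P x) *)
  have xE : x = P x + S h by rewrite Sh addrC subrK.
    rewrite {1}xE mulrDl; apply: le_trans (hnormD _ _) _; [by ell2_tac|by ell2_tac|].
    apply: lerD; last exact: Hs.
    apply: le_trans (fl _ (PN _ hx)) _; rewrite -mulrA ler_pM2l // fh.
    apply: le_trans (hnormB _ _) _; [by []|by ell2_tac|].
    rewrite mulrDl mul1r lerD2l -mulrA.
    by apply: le_trans (Hv _ (BopE hS hh)) _; rewrite ler_pM2l //; exact: Hs.
have hKS2 : Bop (fun x => K (E (S x))) by exact: Bop_comp.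
have KS2b x : ell2 x -> hnorm (K (E (S x))) <= 2^-1 * hnorm x.
  move=> hx; have [h1 _] := Eb _ (BopE hS hx); apply: le_trans h1 _.
  apply: (@le_trans _ _ (2^-1 / s * (s * hnorm x))).
    by rewrite ler_pM2l //; exact: Hs.
  by rewrite mulrA divfK // gt_eqF.
have [V hV _] := inverse_half hKS2 KS2b.
have [W hW] := inverse_swap hS2 hK hV.
exact: plus_perturb hF data hK hW.
Qed.

(** S E is an outer inverse of F because E F S = E (1 - P) = E, and the kernel of S E
is that of E.  The map h x = f (P x) + S x sends ker E to ker (S E F), and it is
bounded below since S F (h x) = S x. *)
Lemma minus_compact F K : Bop F -> tail_small K -> (exists S, minus_data F S) ->
  exists S, minus_data (F \+ K) S.
Proof.
move=> hF hKt [S [[hS SFS] fgN [f [flin fN fb /lower_gt0[c c0 fl]]]]].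
have [hK _] := hKt.
pose N := ker S.
have hFS := Bop_comp hF hS; have hSF := Bop_comp hS hF.
pose P x := x - F (S x).
have hP : Bop P by exact: Bop_sub Bop_id hFS.
have PN x : ell2 x -> N (P x).
  move=> hx; split; first by ell2_tac.
  by rewrite /P (BopB hS) ?SFS ?subrr //; ell2_tac.
have NP x : N x -> P x = x by move=> [hx e]; rewrite /P e (Bop0 hF) subr0.
have [s s0 Hs] := Bop_bound hS.
have d0 : 0 < 2^-1 / s by rewrite divr_gt0 // invr_gt0.
have [E [hE EE EP fgE Eb]] := cofinite_projection hKt hP (ker_closed hS) fgN PN NP d0.
have EN x : N x -> E x = 0 by move=> Nx; rewrite -(NP _ Nx) EP //; case: Nx.
have EFS x : ell2 x -> E (F (S x)) = E x.
  move=> hx; have -> : F (S x) = x - P x by rewrite /P subKr.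
  by rewrite (BopB hE) ?EP ?subr0 //; ell2_tac.
have hS2 : Bop (fun x => S (E x)) by exact: Bop_comp.
have [lD lr] := flin.
have fl2 x : ell2 x -> ell2 (f (P x)) by move=> /PN /fN [].
have SFf x : ell2 x -> S (F (f (P x))) = 0 by move=> /PN /fN [].
have kE : ker (fun x => S (E x)) = ker E.
  apply/seteqP; split=> x [hx e]; split=> //=; last by rewrite e Bop0.
  by rewrite -EE // -EFS ?e ?(Bop0 hF) ?(Bop0 hE) //; ell2_tac.
have data : minus_data F (fun x => S (E x)).
  split; first by split=> // x hx; rewrite EFS ?EE //; ell2_tac.
    by rewrite kE.
  rewrite kE; exists (fun x => f (P x) + S x).
  have [t t0 Ht] := bounded_gt0 fb.
  have [p p0 Hp] := Bop_bound hP; have [v v0 Hv] := Bop_bound hF.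
  split.
  - split=> [x y [hx _] [hy _]|x a [hx _]].
      rewrite (BopD hP) // lD; [|exact: PN|exact: PN].
      by rewrite (BopD hS) // addrACA.
    rewrite (Bop_rmul _ hP) // lr; last exact: PN.
    by rewrite (Bop_rmul _ hS) // rmulDl.
  - move=> x [hx Ex]; have hf := fl2 _ hx; split; first by ell2_tac.
    have hd : ell2 (f (P x) + S x) by ell2_tac.
    rewrite /= (BopD hF) ?(BopD hE) ?EFS ?Ex ?addr0; try by ell2_tac.
    by rewrite EN ?(Bop0 hS) //; split; [ell2_tac|exact: SFf].
  - exists (t * p + s) => x [hx _].
    apply: le_trans (hnormD (fl2 _ hx) (BopE hS hx)) _.
    rewrite mulrDl; apply: lerD; last exact: Hs.
    apply: le_trans (Ht _ (PN _ hx)) _; rewrite -mulrA ler_pM2l //; exact: Hp.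
  - exists (c * (1 + s * v) + v * (s * v)) => x [hx _].
    have hf := fl2 _ hx.
    set h := f (P x) + S x.
    have hh : ell2 h by rewrite /h; ell2_tac.
    have Sh : S (F h) = S x.
      by rewrite /h (BopD hSF) ?SFf ?add0r ?SFS //; ell2_tac.
    have fh : f (P x) = h - S (F h) by rewrite Sh /h addrK.
    have xE : x = P x + F (S (F h)) by rewrite Sh /P subrK.
    have SFb : hnorm (S (F h)) <= s * v * hnorm h.
      apply: le_trans (Hs _ (BopE hF hh)) _; rewrite -mulrA ler_pM2l //; exact: Hv.
    rewrite {1}xE mulrDl; apply: le_trans (hnormD _ _) _; [by ell2_tac|by ell2_tac|].
    apply: lerD.
      apply: le_trans (fl _ (PN _ hx)) _; rewrite -mulrA ler_pM2l // fh.
      apply: le_trans (hnormB _ _) _; [by []|by ell2_tac|].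
      by rewrite mulrDl mul1r lerD2l.
    apply: le_trans (Hv _ _) _; first by ell2_tac.
    by rewrite -mulrA ler_pM2l.
have hSK : Bop (fun x => S (E (K x))) by exact: Bop_comp hS (Bop_comp hE hK).
have SKb x : ell2 x -> hnorm (S (E (K x))) <= 2^-1 * hnorm x.
  move=> hx; have [_ h1] := Eb _ hx.
  apply: le_trans (Hs _ _) _; first by ell2_tac.
  apply: (@le_trans _ _ (s * (2^-1 / s * hnorm x))); first by rewrite ler_pM2l.
  by rewrite mulrA mulrCA mulfV ?mulr1 // gt_eqF.
have [V hV _] := inverse_half hSK SKb.
exact: minus_perturb hF data hK hV.
Qed.

(** The radius is half the inverse of a bound of S, so that S (G - F) has norm at most
one half. *)
Lemma small_perturbation F S : Bop F -> Bop S ->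
  exists2 e, 0 < e & forall G, Bop G -> opnorm (G \- F) < e ->
    [/\ Bop (G \- F), G = F \+ (G \- F) &
      exists V, inverts_1D (fun x => S ((G \- F) x)) V].
Proof.
move=> hF hS; have [s s0 Hs] := Bop_bound hS.
exists (2^-1 / s) => [|G hG Ge]; first by rewrite divr_gt0 // invr_gt0.
have hD : Bop (G \- F) by exact: Bop_sub.
split=> //; first by apply/funext => x; rewrite /= addrC subrK.
have [|V hV _] := inverse_half (Bop_comp hS hD); last by exists V.
move=> x hx; apply: le_trans (Hs _ (BopE hD hx)) _.
apply: (@le_trans _ _ (s * (2^-1 / s * hnorm x))).
  rewrite ler_pM2l //; apply: le_trans (opnorm_bound hD hx) _.
  by rewrite ler_wpM2r ?hnorm_ge0 // ltW.
by rewrite mulrA mulrCA mulfV ?mulr1 // gt_eqF.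
Qed.

End Perturbation.


Theorem lemma5p9 (R : realType) (A : cstarAlgType R) :
  [/\ open_in_Ba (MPhi_minus_plus' A),
      open_in_Ba (MPhi_plus_minus' A),
      forall F K : A ^nat -> A ^nat,
        MPhi_plus_minus' A F -> compact_op A K ->
        MPhi_plus_minus' A (F \+ K) &
      forall F K : A ^nat -> A ^nat,
        MPhi_minus_plus' A F -> compact_op A K ->
        MPhi_minus_plus' A (F \+ K)].
Proof.
split.
- split=> [F [] //|F /MPhi_minusP [/Ba_Bop hF [S dS]]].
  have [[hS _] _ _] := dS.
  have [e e0 He] := small_perturbation hF hS.
  exists e => // G bG /(He _ (Ba_Bop bG)) [hD GE [V hV]].
  apply/MPhi_minusP; split=> //.
  by rewrite GE; exact: minus_perturb hF dS hD hV.
- split=> [F [] //|F /MPhi_plusP [/Ba_Bop hF [S dS]]].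
  have [[hS _] _ _] := dS.
  have [e e0 He] := small_perturbation hF hS.
  exists e => // G bG /(He _ (Ba_Bop bG)) [hD GE [V hV]].
  apply/MPhi_plusP; split=> //.
  by rewrite GE; exact: plus_perturb hF dS hD hV.
- move=> F K /MPhi_plusP [bF dF] cK; apply/MPhi_plusP; split.
    by apply: Ba_add => //; case: cK.
  exact: plus_compact (Ba_Bop bF) (tail_small_compact cK) dF.
- move=> F K /MPhi_minusP [bF dF] cK; apply/MPhi_minusP; split.
    by apply: Ba_add => //; case: cK.
  exact: minus_compact (Ba_Bop bF) (tail_small_compact cK) dF.
Qed.
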